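(* Let $X\colon\overline B\to\mathbb R^4$ be a conformally parametrized immersion and let $\widetilde N=(\widetilde N_1,\widetilde N_2)$ be a given normal frame of $X$ with torsion coefficients $\widetilde T_{\sigma,i}^\vartheta$. Let $\varphi=\varphi(u,v)$ be a (sufficiently regular) rotation angle on $\overline B$ and let $N=(N_1,N_2)$ be the normal frame determined by $$\widetilde N_1=\cos\varphi\,N_1+\sin\varphi\,N_2,\qquad \widetilde N_2=-\sin\varphi\,N_1+\cos\varphi\,N_2 .$$ Then $N$ is a normal Coulomb frame if and only if $$\Delta\varphi=\mathrm{div}\,(\widetilde T_{1,1}^2,\widetilde T_{1,2}^2)\ \text{ in } B,\qquad \frac{\partial\varphi}{\partial\nu}=(\widetilde T_{1,1}^2,\widetilde T_{1,2}^2)\cdot\nu\ \text{ on }\partial B,$$ where $\nu$ is the outer unit normal along $\partial B$.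
   Context: $B=\{(u,v)\in\mathbb R^2: u^2+v^2<1\}$; $u^1=u$, $u^2=v$. Immersions satisfy $X\in C^{k,\beta}(\overline B,\mathbb R^{4})$ for some integer $k\ge3$ and $\beta\in(0,1)$, with $\mathrm{rank}\,DX=2$ on $\overline B$. Conformally parametrized: $X_u\cdot X_u=X_v\cdot X_v=W$, $X_u\cdot X_v=0$ on $\overline B$. A normal frame is a pair $N=(N_1,N_2)$ of maps in $C^{k-1,\beta}(\overline B,\mathbb R^4)$ with $N_\sigma\cdot N_\vartheta=\delta_{\sigma\vartheta}$, $N_\sigma\cdot X_{u^i}=0$, $\det(X_u,X_v,N_1,N_2)>0$. Torsion coefficients: $T_{\sigma,i}^\vartheta=N_{\sigma,u^i}\cdot N_\vartheta$ (and $\widetilde T_{\sigma,i}^\vartheta=\widetilde N_{\sigma,u^i}\cdot\widetilde N_\vartheta$). Total torsion (in conformal parameters): $\mathcal T(N)=2\iint_B\{(T_{1,1}^2)^2+(T_{1,2}^2)^2\}\,du\,dv$. $N$ is a normal Coulomb frame if it is critical for $\mathcal T$ with respect to rotations of the pair $(N_1,N_2)$: for every smooth $\psi$ on $\overline B$, the derivative at $\varepsilon=0$ of $\mathcal T$ evaluated on $(\cos(\varepsilon\psi)N_1+\sin(\varepsilon\psi)N_2,\,-\sin(\varepsilon\psi)N_1+\cos(\varepsilon\psi)N_2)$ vanishes. Regularity of $\varphi$: $\varphi\in C^{k-1,\beta}(\overline B)$. *)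

(* Defs.v *)
From HB Require Import structures.
From mathcomp Require Import all_boot all_order all_algebra.
From mathcomp Require Import all_classical all_reals all_analysis.

Set Implicit Arguments.
Unset Strict Implicit.
Unset Printing Implicit Defensive.
Import Order.TTheory GRing.Theory Num.Theory.
Import numFieldNormedType.Exports.
Local Open Scope classical_set_scope.
Local Open Scope ring_scope.

Definition disk (R : realType) : set (R * R) :=
  [set z | z.1 ^+ 2 + z.2 ^+ 2 < 1].

Definition closed_disk (R : realType) : set (R * R) :=
  [set z | z.1 ^+ 2 + z.2 ^+ 2 <= 1].

Definition unit_circle (R : realType) : set (R * R) :=
  [set z | z.1 ^+ 2 + z.2 ^+ 2 = 1].

Arguments disk R : clear implicits.
Arguments closed_disk R : clear implicits.
Arguments unit_circle R : clear implicits.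

(* The indices 1, 2 of coordinates, normals and torsion coefficients are
   rendered as 0, 1 : 'I_2. *)
Definition basis_vec (R : realType) (i : 'I_2) : R * R :=
  if i == 0 then (1, 0) else (0, 1).

Definition coord2 (R : realType) (i : 'I_2) (z : R * R) : R :=
  if i == 0 then z.1 else z.2.

(* The derivative of f in the direction u^i as a map on the closed disk: the
   continuous extension of the partial derivative taken in the open disk.  When
   the limit exists at a point z of the open disk, it is ['D_(basis_vec R i) f z],
   since the filter [within (disk R) (nbhs z)] does not exclude z itself. *)
Definition pderiv (R : realType) (V : normedModType R) (i : 'I_2)
    (f : R * R -> V) : R * R -> V :=
  fun z => lim ((fun w => 'D_(basis_vec R i) f w) @ within (disk R) (nbhs z)).

Definition pderivs (R : realType) (V : normedModType R) (s : seq 'I_2)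
    (f : R * R -> V) : R * R -> V :=
  foldr (@pderiv R V) f s.

(* f is of class C^k on the closed disk: in the open disk, all the iterated
   partial derivatives of order at most k exist, and they extend continuously to
   the closed disk. Values of f outside of the closed disk are irrelevant. *)
Definition Ck_closed_disk (R : realType) (V : normedModType R) (k : nat)
    (f : R * R -> V) : Prop :=
  (forall s : seq 'I_2, (size s <= k)%N ->
     {within closed_disk R, continuous (pderivs s f)}) /\
  (forall (s : seq 'I_2) (i : 'I_2), (size s < k)%N ->
     (forall z, disk R z -> derivable (pderivs s f) z (basis_vec R i)) /\
     (forall z, closed_disk R z ->
        cvg ((fun w => 'D_(basis_vec R i) (pderivs s f) w)
               @ within (disk R) (nbhs z)))).

Definition smooth_closed_disk (R : realType) (V : normedModType R)
    (f : R * R -> V) : Prop :=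
  forall k : nat, Ck_closed_disk k f.

(* The library norms on R * R and 'rV[R]_n are sup norms; they are equivalent to
   the Euclidean ones, so this is the usual Hoelder condition. *)
Definition holder_on (R : realType) (V : normedModType R) (A : set (R * R))
    (beta : R) (f : R * R -> V) : Prop :=
  exists C : R, forall x y, A x -> A y ->
    `|f x - f y| <= C * `|x - y| `^ beta.

Definition Ckb_closed_disk (R : realType) (V : normedModType R) (k : nat)
    (beta : R) (f : R * R -> V) : Prop :=
  Ck_closed_disk k f /\
  (forall s : seq 'I_2, size s = k ->
     holder_on (closed_disk R) beta (pderivs s f)).

Definition dotv (R : realType) (n : nat) (x y : 'rV[R]_n) : R :=
  \sum_(j < n) x 0 j * y 0 j.

Definition immersion (R : realType) (k : nat) (beta : R)
    (X : R * R -> 'rV[R]_4) : Prop :=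
  Ckb_closed_disk k beta X /\
  (forall z, closed_disk R z -> \rank (\matrix_(i < 2) pderiv i X z) = 2%N).

Definition conformal (R : realType) (X : R * R -> 'rV[R]_4) : Prop :=
  forall z, closed_disk R z ->
    dotv (pderiv 0 X z) (pderiv 0 X z) = dotv (pderiv 1 X z) (pderiv 1 X z) /\
    dotv (pderiv 0 X z) (pderiv 1 X z) = 0.

(* For an immersion X of class C^{k,beta}. *)
Definition normal_frame (R : realType) (k : nat) (beta : R)
    (X : R * R -> 'rV[R]_4) (N : 'I_2 -> R * R -> 'rV[R]_4) : Prop :=
  (forall sigma, Ckb_closed_disk k.-1 beta (N sigma)) /\
  (forall z, closed_disk R z ->
     [/\ forall sigma theta, dotv (N sigma z) (N theta z) = (sigma == theta)%:R,
         forall sigma i, dotv (N sigma z) (pderiv i X z) = 0 &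
         0 < \det (\matrix_(r < 4)
               nth 0 [:: pderiv 0 X z; pderiv 1 X z; N 0 z; N 1 z] r)]).

(* [torsion N sigma i theta] is T_{sigma,i}^theta. *)
Definition torsion (R : realType) (N : 'I_2 -> R * R -> 'rV[R]_4)
    (sigma i theta : 'I_2) (z : R * R) : R :=
  dotv (pderiv i (N sigma) z) (N theta z).

(* The total torsion in conformal parameters. *)
Definition total_torsion (R : realType) (N : 'I_2 -> R * R -> 'rV[R]_4) : R :=
  2 * \int[(@lebesgue_measure R \x @lebesgue_measure R)%E]_(z in disk R)
        (torsion N 0 0 1 z ^+ 2 + torsion N 0 1 1 z ^+ 2).

Definition rotate_frame (R : realType) (phi : R * R -> R)
    (N : 'I_2 -> R * R -> 'rV[R]_4) : 'I_2 -> R * R -> 'rV[R]_4 :=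
  fun sigma z =>
    if sigma == 0 then cos (phi z) *: N 0 z + sin (phi z) *: N 1 z
    else - sin (phi z) *: N 0 z + cos (phi z) *: N 1 z.

Definition coulomb_frame (R : realType) (k : nat) (beta : R)
    (X : R * R -> 'rV[R]_4) (N : 'I_2 -> R * R -> 'rV[R]_4) : Prop :=
  normal_frame k beta X N /\
  (forall psi : R * R -> R, smooth_closed_disk psi ->
     is_derive (0 : R) 1
       (fun eps : R => total_torsion (rotate_frame (fun z => eps * psi z) N)) 0).

Definition divergence (R : realType) (F : 'I_2 -> R * R -> R) (z : R * R) : R :=
  \sum_(i < 2) 'D_(basis_vec R i) (F i) z.

Definition laplacian (R : realType) (f : R * R -> R) (z : R * R) : R :=
  divergence (fun i w => 'D_(basis_vec R i) f w) z.

(* The outer unit normal of the disk at a point of the unit circle is the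
   position vector of that point. *)
Definition normal_component (R : realType) (F : 'I_2 -> R * R -> R)
    (z : R * R) : R :=
  \sum_(i < 2) F i z * coord2 i z.

Definition normal_derivative (R : realType) (f : R * R -> R) (z : R * R) : R :=
  normal_component (fun i => pderiv i f) z.

(* Main.v *)
(* Rotating N by an angle phi adds the gradient of phi to the vector field
   T = (T_{1,1}^2, T_{1,2}^2): the field of the given frame is that of N plus
   grad phi.  Hence the total torsion of N rotated by eps psi is quadratic in
   eps, with linear coefficient 4 \int_B T . grad psi, and the two equations for
   phi say that div T = 0 in B and T . nu = 0 on the circle.

   A function that vanishes on the circle and has a partial derivative continuous
   up to the boundary integrates to 0 when differentiated (Fubini and the
   fundamental theorem of calculus), which gives integration by parts without
   boundary terms for test functions that vanish on the circle.

   Criticality implies the equations by testing with polynomials.  Powers K^n of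
   a polynomial K with values in [0, 1] on the disk and a peak K(z0) = 1
   concentrate at z0.  For z0 in B, psi = (1 - |z|^2) K^n isolates div T at z0.
   For z0 on the circle and K(z) = (1 + z . z0) / 2, grad (K^(n+1)) is
   (n+1) K^n z0 / 2, so psi = K^(n+1) isolates T(z0) . z0.

   Conversely, if div T = 0 and T . nu = 0, the integral of
   T . grad (psi (1 - |z|^(2n))) vanishes and tends to that of T . grad psi:
   since |T . z| <= C (1 - |z|^2), the extra term is bounded, because
   n s^(n-1) (1 - s) <= 1, and dominated convergence applies. *)
Require Import Defs.
From HB Require Import structures.
From mathcomp Require Import all_boot all_order all_algebra.
From mathcomp Require Import all_classical all_reals all_analysis.
From mathcomp Require Import measurable_realfun ring lra.
Set Implicit Arguments.
Unset Strict Implicit.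
Unset Printing Implicit Defensive.
Import Order.TTheory GRing.Theory Num.Theory.
Import numFieldNormedType.Exports.
Local Open Scope classical_set_scope.
Local Open Scope ring_scope.

(** * Topology of the open and closed disks *)

Section disk_topology.
Context {R : realType}.
Implicit Types z w : R * R.

Lemma disk_closed_disk z : disk R z -> closed_disk R z.
Proof. by move=> /ltW. Qed.

Lemma continuous_sqnorm : continuous (fun z : R * R => z.1 ^+ 2 + z.2 ^+ 2).
Proof.
move=> z; rewrite /continuous_at; under eq_fun do rewrite !expr2; rewrite !expr2.
by apply: cvgD; apply: cvgM; (exact: cvg_fst || exact: cvg_snd).
Qed.

Lemma open_disk : open (disk R).
Proof.
rewrite [disk R](_ : _ = (fun z => z.1 ^+ 2 + z.2 ^+ 2) @^-1` [set x | x < 1])//.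
by apply: open_comp => [? _|]; [exact: continuous_sqnorm|exact: open_lt].
Qed.

Lemma near_disk z : disk R z -> \forall w \near z, disk R w.
Proof. by move=> Dz; apply: open_nbhs_nbhs; split => //; exact: open_disk. Qed.

Lemma within_disk z : disk R z -> within (disk R) (nbhs z) = nbhs z.
Proof.
move=> Dz; apply/seteqP; split => A; rewrite /within /=.
  by move=> DA; apply: filterS2 (near_disk Dz) DA => w Dw /(_ Dw).
by apply: filterS => w Aw _.
Qed.

(** Every z is the limit of t z as t < 1 tends to 1. This makes the filters
    [within (disk R) (nbhs z)] proper up to the circle, so that limits along them are unique. *)
Lemma closed_disk_closure : closed_disk R `<=` closure (disk R).
Proof.
move=> z Dz A Az.
have cz : (fun t : R => t *: z) @ (1 : R) --> z.
  rewrite -[X in _ --> X]scale1r.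
  by apply: cvgZ; [exact: cvg_id|exact: cvg_cst].
have [e /= e0 eA] := cz _ Az.
(* The shift [e / 2] is within the tolerance, and its cap at 1 keeps [t] nonnegative. *)
pose t := 1 - Num.min (e / 2) 1.
have t0 : 0 <= t by rewrite subr_ge0 ge_min lexx orbT.
have t1 : t < 1 by rewrite ltrBlDr ltrDl lt_min ltr01 divr_gt0.
exists (t *: z); split.
  rewrite /disk /= !exprMn -mulrDr (le_lt_trans (_ : _ <= t ^+ 2 * 1))//.
    by apply: ler_wpM2l => //; exact: sqr_ge0.
  by rewrite mulr1 exprn_ilt1.
apply: eA; rewrite /ball_/= opprB addrC subrK ger0_norm.
  by rewrite gt_min [e / 2 < e]ltr_pdivrMr// ltr_pMr ?ltr1n.
by rewrite le_min ler01 divr_ge0// ltW.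
Qed.

Lemma within_disk_proper z : closed_disk R z ->
  ProperFilter (within (disk R) (nbhs z)).
Proof. by move=> Dz; apply: within_nbhs_proper; exact: closed_disk_closure. Qed.

End disk_topology.

(** * Partial derivatives up to the boundary and Hoelder classes *)

Section partial_derivatives.
Context {R : realType} {V : normedModType R}.
Implicit Types f g : R * R -> V.

Definition cont_closed_disk f := {within closed_disk R, continuous f}.

Lemma cont_closed_diskP f : cont_closed_disk f <->
  forall z, closed_disk R z -> f @ within (closed_disk R) (nbhs z) --> f z.
Proof. exact: subspace_continuousP. Qed.

Lemma cont_closed_disk_ext f g : (forall z, closed_disk R z -> f z = g z) ->
  cont_closed_disk f -> cont_closed_disk g.
Proof.
move=> fg /cont_closed_diskP cf; apply/cont_closed_diskP => z Dz; rewrite -fg//.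
apply: cvg_trans (cf z Dz); apply: near_eq_cvg.
by rewrite near_withinE; apply: nearW => w; exact: fg.
Qed.

Lemma cont_closed_disk_lim f z : cont_closed_disk f -> closed_disk R z ->
  f @ within (disk R) (nbhs z) --> f z.
Proof.
move=> /cont_closed_diskP cf Dz; apply: cvg_trans (cf z Dz).
by apply: cvg_app; apply: within_subset; exact: disk_closed_disk.
Qed.

(** A relational counterpart of [pderiv]: the rules of calculus are proved for it without computing
    limits, and [pderivE] converts back. Continuity of [g] on the closed disk fixes its values on
    the circle. *)
Definition is_pderiv (i : 'I_2) f g :=
  [/\ cont_closed_disk f, cont_closed_disk g &
      forall z, disk R z -> is_derive z (basis_vec R i) f (g z)].

Lemma is_pderiv_ext i f f' g g' :
  (forall z, closed_disk R z -> f z = f' z) ->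
  (forall z, closed_disk R z -> g z = g' z) ->
  is_pderiv i f g -> is_pderiv i f' g'.
Proof.
move=> ff' gg' [cf cg fg]; split.
- exact: cont_closed_disk_ext cf.
- exact: cont_closed_disk_ext cg.
- move=> z Dz; rewrite -gg'; last exact: disk_closed_disk.
  apply: near_eq_is_derive (fg z Dz); have := near_disk Dz.
  by apply: filterS => w /disk_closed_disk; exact: ff'.
Qed.

Lemma is_pderiv_cvg i f g z : is_pderiv i f g -> closed_disk R z ->
  (fun w => 'D_(basis_vec R i) f w) @ within (disk R) (nbhs z) --> g z.
Proof.
move=> [_ cg fg] Dz; apply: cvg_trans (cont_closed_disk_lim cg Dz).
apply: near_eq_cvg; rewrite near_withinE; apply: nearW => w Dw.
by have [] := fg w Dw.
Qed.

Lemma pderivE i f g z : is_pderiv i f g -> closed_disk R z ->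
  pderiv i f z = g z.
Proof.
move=> fg Dz; have ? := within_disk_proper Dz.
by apply: cvg_lim; [exact: norm_hausdorff|exact: is_pderiv_cvg].
Qed.

Lemma Ck_closed_disk_is_pderiv i k f : Ck_closed_disk k.+1 f ->
  is_pderiv i f (pderiv i f).
Proof.
move=> [cf df]; split; [exact: (cf [::])|exact: (cf [:: i])|move=> z Dz].
have [/(_ z Dz) fd /(_ z (disk_closed_disk Dz)) fc] := df [::] i isT.
split=> //; rewrite /pderiv within_disk//; rewrite within_disk// in fc.
(* Neighbourhoods of z contain z itself, so the limit of the derivative at z can only be its value
   there. *)
have : 'D_(basis_vec R i) f w @[w --> z] --> 'D_(basis_vec R i) f z.
  move/cvg_ex: fc => -[l fl]; suff <- : l = 'D_(basis_vec R i) f z by [].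
  apply: norm_hausdorff => A B lA zB; exists ('D_(basis_vec R i) f z); split.
    by have := fl _ lA; exact: nbhs_singleton.
  exact: nbhs_singleton.
by move/cvg_lim => ->//; exact: norm_hausdorff.
Qed.

(* The class C^{k,beta} of the closed disk, peeling off the innermost derivative
   so that the product and chain rules go through by induction on k. *)
Fixpoint holder_class (beta : R) k f : Prop :=
  if k is k'.+1 then
    forall i, exists2 g, is_pderiv i f g & holder_class beta k' g
  else cont_closed_disk f /\ holder_on (closed_disk R) beta f.

Lemma holder_class_ext beta k f g :
  (forall z, closed_disk R z -> f z = g z) ->
  holder_class beta k f -> holder_class beta k g.
Proof.
elim: k f g => [|k IH] f g fg /=.
  move=> [cf [C fC]]; split; first exact: cont_closed_disk_ext cf.
  by exists C => x y Dx Dy; rewrite -!fg//; exact: fC.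
move=> fd i; have [h fh hh] := fd i; exists h => //.
exact: is_pderiv_ext fg _ fh.
Qed.

Lemma pderivs_rcons s i f : pderivs (rcons s i) f = pderivs s (pderiv i f).
Proof. by rewrite /pderivs foldr_rcons. Qed.

(** [pderivs] applies the last index of the list first. Lists are therefore split at their end,
    which matches the innermost derivative peeled off by [holder_class]. *)
Lemma Ckb_closed_diskP k beta f :
  Ckb_closed_disk k beta f <-> holder_class beta k f.
Proof.
split.
  elim: k f => [|k IH] f /=.
    by move=> [[cf _] hf]; split; [exact: (cf [::])|exact: (hf [::])].
  move=> [[cf df] hf] i; exists (pderiv i f).
    exact: (@Ck_closed_disk_is_pderiv _ k).
  apply: IH; split; [split|].
  - by move=> s sk; rewrite -pderivs_rcons; apply: cf; rewrite size_rcons.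
  - by move=> s j sk; rewrite -pderivs_rcons; apply: df; rewrite size_rcons.
  - by move=> s sk; rewrite -pderivs_rcons; apply: hf; rewrite size_rcons sk.
elim: k f => [|k IH] f /=.
  move=> [cf hf]; split; [split|].
  - by move=> [].
  - by [].
  - by move=> [].
move=> fd.
have fdi i : Ckb_closed_disk k beta (pderiv i f).
  have [g fg hg] := fd i; apply: IH; apply: holder_class_ext hg => z Dz.
  by rewrite (pderivE fg).
split; [split|].
- case/lastP => [_|s i]; first by have [g []] := fd 0.
  rewrite size_rcons ltnS pderivs_rcons => sk.
  by have [[cf _] _] := fdi i; exact: cf.
- case/lastP => [|s j] i.
    move=> _ /=; have [g fg _] := fd i; split => z Dz.
      by have [_ _ /(_ z Dz)[]] := fg.
    by apply/cvg_ex; exists (g z); exact: is_pderiv_cvg.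
  rewrite size_rcons ltnS pderivs_rcons => sk.
  by have [[_ df] _] := fdi j; exact: df.
- case/lastP => // s i; rewrite size_rcons pderivs_rcons => -[sk].
  by have [_ hf] := fdi i; exact: hf.
Qed.

End partial_derivatives.

(** * Reduction of vector-valued functions to their coordinates *)

Section row_vectors.
Context {R : realType} {n : nat}.
Implicit Types (f g : R * R -> 'rV[R]_n).

Lemma ler_norm_rV (x : 'rV[R]_n) e : 0 <= e ->
  `|x| <= e <-> forall j, `|x 0 j| <= e.
Proof.
move=> e0; rewrite [`|x|]mx_normrE; split => [xe j|xe].
  by apply: le_trans xe; exact: (le_bigmax _ (fun i => `|x i.1 i.2|) (0, j)).
by apply: bigmax_le => // -[i j] _; rewrite /= ord1.
Qed.

Lemma ler_norm_rV_coord (x : 'rV[R]_n) j : `|x 0 j| <= `|x|.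
Proof. exact: (ler_norm_rV x (normr_ge0 x)).1. Qed.

Lemma cvg_rVP (T : Type) (F : set_system T) {FF : Filter F}
    (h : T -> 'rV[R]_n) (l : 'rV[R]_n) :
  h @ F --> l <-> forall j, (fun t => h t 0 j) @ F --> l 0 j.
Proof.
split=> [hl j|hl]; apply/cvgrPdist_le => e e0.
  have /cvgrPdist_le/(_ e e0) := hl; apply: filterS => t.
  move=> le_e; apply: (le_trans _ le_e).
  by have := ler_norm_rV_coord (l - h t) j; rewrite !mxE.
near=> t; apply/ler_norm_rV; first exact: ltW.
near: t; apply: filter_forall => j; have /cvgrPdist_le/(_ e e0) := hl j.
by apply: filterS => t; rewrite !mxE.
Unshelve. all: by end_near. Qed.

Lemma cont_closed_disk_rV f :
  cont_closed_disk f <-> forall j, cont_closed_disk (fun z => f z 0 j).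
Proof.
split=> [/cont_closed_diskP cf j|cf].
  by apply/cont_closed_diskP => z Dz; move/cvg_rVP : (cf z Dz); exact.
apply/cont_closed_diskP => z Dz; apply/cvg_rVP => j.
by move/cont_closed_diskP : (cf j); exact.
Qed.

Lemma is_derive_rV f z v d :
  is_derive z v f d <-> forall j, is_derive z v (fun w => f w 0 j) (d 0 j).
Proof.
split=> [[fd <-] j|fd].
  split; first by move/derivable_mxP : fd; exact.
  by rewrite derive_mx// mxE.
have fz : derivable f z v.
  by apply/derivable_mxP => i j; rewrite ord1; have [] := fd j.
split=> //; rewrite derive_mx//; apply/rowP => j; rewrite mxE.
by have [] := fd j.
Qed.

Lemma is_pderiv_rV i f g :
  is_pderiv i f g <-> forall j, is_pderiv i (fun z => f z 0 j) (fun z => g z 0 j).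
Proof.
split=> [[cf cg fg] j|fg]; split.
- by move: j; exact/cont_closed_disk_rV.
- by move: j; exact/cont_closed_disk_rV.
- by move=> z Dz; move: j; apply/is_derive_rV; exact: fg.
- by apply/cont_closed_disk_rV => j; have [] := fg j.
- by apply/cont_closed_disk_rV => j; have [] := fg j.
- by move=> z Dz; apply/is_derive_rV => j; have [_ _ ] := fg j; exact.
Qed.

Lemma holder_on_rV A beta f :
  holder_on A beta f <-> forall j, holder_on A beta (fun z => f z 0 j).
Proof.
split=> [[C fC] j|fC].
  exists C => x y Ax Ay; apply: le_trans (fC x y Ax Ay).
  by have := ler_norm_rV_coord (f x - f y) j; rewrite !mxE.
have /choice[C {}fC] := fC.
(* Hoelder constants may be negative, so their absolute values are summed. *)
exists (\sum_j `|C j|) => x y Ax Ay; apply/ler_norm_rV => [|j].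
  by rewrite mulr_ge0 ?powR_ge0// sumr_ge0.
rewrite !mxE; apply: le_trans (fC j x y Ax Ay) _.
apply: ler_wpM2r; first exact: powR_ge0.
rewrite (bigD1 j)//= (le_trans (ler_norm _))// lerDl sumr_ge0//.
Qed.

Lemma holder_class_rV beta k f :
  holder_class beta k f <-> forall j, holder_class beta k (fun z => f z 0 j).
Proof.
elim: k f => [|k IH] f /=.
  split=> [[cf hf] j|fd].
    by split; move: j; [exact/cont_closed_disk_rV|exact/holder_on_rV].
  split; first by apply/cont_closed_disk_rV => j; have [] := fd j.
  by apply/holder_on_rV => j; have [] := fd j.
split=> [fd j i|fd i].
  have [g fg hg] := fd i; exists (fun z => g z 0 j).
    by move: j; exact/is_pderiv_rV.
  by move: j; exact/IH.
have /choice[g gP] : forall j, exists g : R * R -> R,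
    is_pderiv i (fun z => f z 0 j) g /\ holder_class beta k g.
  by move=> j; have [g] := fd j i; exists g.
exists (fun z => \row_j g j z).
  apply/is_pderiv_rV => j; have [+ _] := gP j.
  by apply: is_pderiv_ext => // z _; rewrite mxE.
apply/IH => j; have [_] := gP j.
by apply: holder_class_ext => z _; rewrite mxE.
Qed.

End row_vectors.

Lemma ord2P (i : 'I_2) : i = 0 \/ i = 1.
Proof. by case: i => -[|[|//]] ?; [left|right]; exact: val_inj. Qed.

(** * Differential calculus of scalar functions on the closed disk *)

Section scalar_functions.
Context {R : realType}.
Implicit Types (f g h : R * R -> R) (z v : R * R).

(** Both difference quotients are the same function of the increment. One-variable tools (chain
    rule, mean value theorem, fundamental theorem of calculus) thus apply along lines. *)
Lemma is_derive_slice f z v (s : R) d :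
  is_derive s 1 (fun t : R => f (t *: v + z)) d <->
  is_derive (s *: v + z) v f d.
Proof.
have E : (fun h : R => h^-1 *: ((f \o shift (s *: v + z)) (h *: v) -
      f (s *: v + z))) =
    (fun h : R => h^-1 *: (((fun t : R => f (t *: v + z)) \o shift s) (h *: 1)
                    - f (s *: v + z))).
  by apply/funext => h /=; rewrite [h *: 1]mulr1 scalerDl addrA.
have dE : derivable f (s *: v + z) v =
    derivable (fun t : R => f (t *: v + z)) s 1 by rewrite /derivable E.
have DE : 'D_v f (s *: v + z) = 'D_1 (fun t : R => f (t *: v + z)) s.
  by rewrite /derive E.
by split=> -[fd fE]; split; [rewrite dE|rewrite DE|rewrite -dE|rewrite -DE].
Qed.

Lemma is_derive_slice0 f z v d :
  is_derive (0 : R) 1 (fun t : R => f (t *: v + z)) d <-> is_derive z v f d.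
Proof. by rewrite is_derive_slice scale0r add0r. Qed.

Lemma is_derive_comp_outer (u : R -> R) f z v d d' :
  is_derive (f z) 1 u d' -> is_derive z v f d ->
  is_derive z v (u \o f) (d' * d).
Proof.
move=> ud /is_derive_slice0 fd; apply/is_derive_slice0.
apply: (@is_derive1_comp _ u (fun t : R => f (t *: v + z))) => //.
by rewrite scale0r add0r.
Qed.

Lemma cont_closed_diskD f g : cont_closed_disk f -> cont_closed_disk g ->
  cont_closed_disk (fun z => f z + g z).
Proof.
move=> /cont_closed_diskP cf /cont_closed_diskP cg.
by apply/cont_closed_diskP => z Dz; apply: cvgD; [exact: cf|exact: cg].
Qed.

Lemma cont_closed_diskM f g : cont_closed_disk f -> cont_closed_disk g ->
  cont_closed_disk (fun z => f z * g z).
Proof.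
move=> /cont_closed_diskP cf /cont_closed_diskP cg.
by apply/cont_closed_diskP => z Dz; apply: cvgM; [exact: cf|exact: cg].
Qed.

Lemma cont_closed_disk_comp (u : R -> R) f : continuous u ->
  cont_closed_disk f -> cont_closed_disk (u \o f).
Proof.
move=> cu /cont_closed_diskP cf; apply/cont_closed_diskP => z Dz.
by apply: continuous_cvg; [exact: cu|exact: cf].
Qed.

Lemma continuous_cont_closed_disk f : continuous f -> cont_closed_disk f.
Proof. exact: continuous_subspaceT. Qed.

Lemma is_pderivD i f g f' g' : is_pderiv i f f' -> is_pderiv i g g' ->
  is_pderiv i (fun z => f z + g z) (fun z => f' z + g' z).
Proof.
move=> [cf cf' ff'] [cg cg' gg']; split; [exact: cont_closed_diskD..|].
by move=> z Dz; apply: is_deriveD; [exact: ff'|exact: gg'].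
Qed.

Lemma is_pderivM i f g f' g' : is_pderiv i f f' -> is_pderiv i g g' ->
  is_pderiv i (fun z => f z * g z) (fun z => f' z * g z + f z * g' z).
Proof.
move=> [cf cf' ff'] [cg cg' gg']; split; first exact: cont_closed_diskM.
  by apply: cont_closed_diskD; exact: cont_closed_diskM.
move=> z Dz; have := ff' z Dz; have := gg' z Dz => ? ?.
by apply: is_derive_eq; rewrite addrC [f' z * _]mulrC.
Qed.

Lemma is_pderiv_comp i (u u' : R -> R) f f' :
  (forall x : R, is_derive x 1 u (u' x)) -> continuous u' -> is_pderiv i f f' ->
  is_pderiv i (fun z => u (f z)) (fun z => u' (f z) * f' z).
Proof.
move=> uu' cu' [cf cf' ff']; split.
- apply: cont_closed_disk_comp cf => x.
  by apply: differentiable_continuous; apply/derivable1_diffP; have [] := uu' x.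
- by apply: cont_closed_diskM => //; exact: (cont_closed_disk_comp cu' cf).
- by move=> z Dz; apply: is_derive_comp_outer => //; exact: ff'.
Qed.

Lemma is_pderiv_cst i (c : R) : is_pderiv i (fun=> c) (fun=> 0).
Proof.
by split=> [||z _]; [exact/continuous_cont_closed_disk/cst_continuous..|
  exact: is_derive_cst].
Qed.

Lemma is_pderiv_coord2 i j : is_pderiv i (@coord2 R j) (fun=> (i == j)%:R).
Proof.
split=> [||z _].
- apply: continuous_cont_closed_disk; rewrite /coord2.
  by case: (j == 0) => z; [exact: cvg_fst|exact: cvg_snd].
- exact/continuous_cont_closed_disk/cst_continuous.
- apply/is_derive_slice0.
  rewrite (_ : (fun t => _) = (i == j)%:R *: (@id R) + cst (coord2 j z)).
    by apply: is_derive_eq; rewrite addr0 /GRing.scale/= mulr1.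
  apply/funext => t; rewrite /coord2 /basis_vec /GRing.add/= /GRing.scale/=.
  by case: (ord2P i) => ->; case: (ord2P j) => -> /=; 
    rewrite ?mulr1 ?mulr0 ?scale1r ?scale0r.
Qed.

End scalar_functions.

(** * Compactness, chords and Lipschitz bounds *)

Section closed_disk_bounds.
Context {R : realType}.
Implicit Types (f g : R * R -> R) (z : R * R).

Lemma compact_closed_disk : compact (closed_disk R).
Proof.
pose I : set R := [set` `[-1, 1]].
apply: (@subclosed_compact _ _ (I `*` I)).
- rewrite [closed_disk R](_ : _ =
    (fun z => z.1 ^+ 2 + z.2 ^+ 2) @^-1` [set x | x <= 1])//.
  by apply: preimage_closed => [? _|]; [exact: continuous_sqnorm|exact: closed_le].
- by apply: compact_setX; exact: segment_compact.
- move=> z zD; rewrite /closed_disk /= in zD.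
  have sqr_le1 (a b : R) : a ^+ 2 + b ^+ 2 <= 1 -> - 1 <= a <= 1.
    by move=> ab; apply/andP; split; nra.
  by split; rewrite /I /= in_itv/=; [|rewrite addrC in zD]; exact: sqr_le1 zD.
Qed.

Lemma cont_closed_disk_bounded f : cont_closed_disk f ->
  exists2 M, 0 <= M & forall z, closed_disk R z -> `|f z| <= M.
Proof.
move=> /continuous_compact/(_ compact_closed_disk)/compact_bounded[M [_ fM]].
exists (`|M| + 1) => [|z Dz]; first by rewrite addr_ge0.
by apply: (fM (`|M| + 1)); [rewrite ltr_pwDr// ler_norm|exists z].
Qed.

Lemma cont_closed_disk_path (A : set R) (gam : R -> R * R) f :
  continuous gam -> (forall t, A t -> closed_disk R (gam t)) ->
  cont_closed_disk f -> {within A, continuous (f \o gam)}.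
Proof.
move=> cgam gamD /cont_closed_diskP cf; apply/subspace_continuousP => t At.
apply: cvg_comp (cf _ (gamD t At)) => B /(cgam t) Bt.
have {}Bt : \forall s \near t, closed_disk R (gam s) -> B (gam s) by exact: Bt.
by rewrite /within /=; apply: filterS Bt => s sB As; exact/sB/gamD.
Qed.

Lemma continuous_line (v z : R * R) : continuous (fun t : R => t *: v + z).
Proof.
by move=> t; apply: cvgD; [apply: cvgZl; exact: cvg_id|exact: cvg_cst].
Qed.

(** Strict convexity of the disk: derivatives exist along an open chord even when its endpoints are
    on the circle. *)
Lemma disk_segment i z (s t : R) :
  closed_disk R z -> closed_disk R (t *: basis_vec R i + z) ->
  0 < s -> s < t -> disk R (s *: basis_vec R i + z).
Proof.
have cvx (a b : R) : a ^+ 2 + b <= 1 -> (t + a) ^+ 2 + b <= 1 ->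
    0 < s -> s < t -> (s + a) ^+ 2 + b < 1.
  move=> a1 ta1 s0 st; have t0 : 0 < t by exact: lt_trans st.
  rewrite -subr_gt0 -(pmulr_rgt0 _ t0).
  (* With q the squared norm along the chord, t (1 - q(s)) is the linear interpolation of the
     endpoint values plus the positive term t s (t - s). *)
  rewrite (_ : t * _ = (t - s) * (1 - (a ^+ 2 + b)) +
    s * (1 - ((t + a) ^+ 2 + b)) + t * s * (t - s)); last by ring.
  by rewrite ltr_wpDl// ?addr_ge0 ?mulr_ge0 ?mulr_gt0 ?subr_ge0 ?subr_gt0// ltW.
rewrite /disk /closed_disk /basis_vec /= /GRing.scale/=.
move: z => [a b] /=; case: (i == 0); rewrite /= ?mulr1 ?mulr0 ?add0r.
  exact: cvx.
rewrite ![a ^+ 2 + _]addrC; exact: cvx.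
Qed.

(** Mean value theorem on a chord; the endpoints, possibly on the circle, only require
    continuity. *)
Lemma is_pderiv_segment i f g z (t : R) : is_pderiv i f g -> 0 <= t ->
  closed_disk R z -> closed_disk R (t *: basis_vec R i + z) ->
  exists2 w, closed_disk R w & f (t *: basis_vec R i + z) - f z = g w * t.
Proof.
move=> [cf _ fg]; rewrite le_eqVlt => /predU1P[<-|t0] Dz Dt.
  by exists z => //; rewrite scale0r add0r subrr mulr0.
have Ds s : 0 < s -> s < t -> disk R (s *: basis_vec R i + z).
  exact: disk_segment.
have [s||c + fE] := @MVT R (fun s => f (s *: basis_vec R i + z))
    (fun s => g (s *: basis_vec R i + z)) 0 t t0.
- rewrite in_itv/= => /andP[s0 st].
  by apply/is_derive_slice; apply: fg; exact: Ds.
- apply: (cont_closed_disk_path (gam := fun s => s *: basis_vec R i + z)) => //.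
    exact: continuous_line.
  move=> s /=; rewrite in_itv/= le_eqVlt => /andP[/predU1P[<- _|s0]].
    by rewrite scale0r add0r.
  rewrite le_eqVlt => /predU1P[->//|st].
  exact/disk_closed_disk/Ds.
- rewrite in_itv/= => /andP[c0 ct].
  exists (c *: basis_vec R i + z); first exact/disk_closed_disk/Ds.
  by move: fE; rewrite scale0r add0r subr0.
Qed.

(** Compactness bounds the partial derivatives, and the mean value theorem is applied along each
    coordinate direction. *)
Lemma is_pderiv_lipschitz f (g : 'I_2 -> R * R -> R) :
  (forall i, is_pderiv i f (g i)) ->
  exists2 C, 0 <= C & forall x y, closed_disk R x -> closed_disk R y ->
    `|f x - f y| <= C * `|x - y|.
Proof.
move=> fg.
have /choice[M MP] : forall i, exists M, 0 <= M /\
    forall z, closed_disk R z -> `|g i z| <= M.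
  move=> i; have [_ cg _] := fg i.
  by have [M M0 gM] := cont_closed_disk_bounded cg; exists M.
have seg i z (t : R) : 0 <= t -> closed_disk R z ->
    closed_disk R (t *: basis_vec R i + z) ->
    `|f (t *: basis_vec R i + z) - f z| <= M i * t.
  move=> t0 Dz Dt; have [w Dw ->] := is_pderiv_segment (fg i) t0 Dz Dt.
  by rewrite normrM (ger0_norm t0) ler_wpM2r//; have [_] := MP i; exact.
have seg0 a b v : closed_disk R (a, v) -> closed_disk R (b, v) ->
    `|f (a, v) - f (b, v)| <= M 0 * `|a - b|.
  wlog ab : a b / b <= a => [wl|] Da Db.
    case: (leP b a) => [|/ltW] ba; first exact: wl.
    by rewrite distrC [`|a - b|]distrC; exact: wl.
  have E : (a, v) = (a - b) *: basis_vec R 0 + (b, v).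
    by rewrite /basis_vec/=; congr pair => /=;
      rewrite /GRing.scale/= ?mulr1 ?mulr0 ?add0r ?subrK.
  have := seg 0 (b, v) (a - b); rewrite -E subr_ge0 ab.
  by rewrite (ger0_norm (_ : 0 <= a - b)) ?subr_ge0//; exact.
have seg1 a b v : closed_disk R (v, a) -> closed_disk R (v, b) ->
    `|f (v, a) - f (v, b)| <= M 1 * `|a - b|.
  wlog ab : a b / b <= a => [wl|] Da Db.
    case: (leP b a) => [|/ltW] ba; first exact: wl.
    by rewrite distrC [`|a - b|]distrC; exact: wl.
  have E : (v, a) = (a - b) *: basis_vec R 1 + (v, b).
    by rewrite /basis_vec/=; congr pair => /=;
      rewrite /GRing.scale/= ?mulr1 ?mulr0 ?add0r ?subrK.
  have := seg 1 (v, b) (a - b); rewrite -E subr_ge0 ab.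
  by rewrite (ger0_norm (_ : 0 <= a - b)) ?subr_ge0//; exact.
have M0 i : 0 <= M i by have [] := MP i.
exists (M 0 + M 1) => [|x y]; first exact: addr_ge0.
(* One of the two axis-parallel paths from x to y stays in the disk. *)
wlog xy : x y / `|x.1| <= `|y.1| => [wl|] Dx Dy.
  case: (leP `|x.1| `|y.1|) => [|/ltW] xy; first exact: wl.
  by rewrite distrC [`|x - y|]distrC; exact: wl.
move: x y xy Dx Dy => [a b] [c d] /= ac Dx Dy.
have Dm : closed_disk R (a, d).
  apply: le_trans Dy => /=; rewrite lerD2r.
  rewrite -[a ^+ 2]real_normK ?num_real// -[c ^+ 2]real_normK ?num_real//.
  by rewrite ler_sqr ?nnegrE.
rewrite -(subrKA (f (a, d))) (le_trans (ler_normD _ _))// addrC mulrDl.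
rewrite prod_normE/=; apply: lerD.
  by apply: le_trans (seg0 _ _ _ Dm Dy) _; rewrite ler_wpM2l// le_max lexx.
by apply: le_trans (seg1 _ _ _ Dx Dm) _; rewrite ler_wpM2l// le_max lexx orbT.
Qed.

End closed_disk_bounds.

(** * Closure properties of the Hoelder classes *)

Section holder_algebra.
Context {R : realType} (beta : R).
Hypotheses (beta_gt0 : 0 < beta) (beta_le1 : beta <= 1).
Implicit Types (f g : R * R -> R).

(** The distance r is at most 2. If r <= 1 then r <= r^beta; otherwise r^beta >= 1 and r <= 2
    suffices. *)
Lemma ler_powR_closed_disk (x y : R * R) : closed_disk R x -> closed_disk R y ->
  `|x - y| <= 2 * `|x - y| `^ beta.
Proof.
move=> Dx Dy.
have coordB (a b : R) : a ^+ 2 <= 1 -> b ^+ 2 <= 1 -> `|a - b| <= 2.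
  rewrite -(expr1n _ 2) -[a ^+ 2]real_normK ?num_real//.
  rewrite -[b ^+ 2]real_normK ?num_real//.
  rewrite !ler_sqr ?nnegrE// => a1 b1.
  by apply: le_trans (ler_normB _ _) _; apply: le_trans (lerD a1 b1) _; lra.
have : `|x - y| <= 2.
  move: x y Dx Dy => [a b] [c d]; rewrite /closed_disk/= prod_normE/= => Dx Dy.
  by rewrite ge_max !coordB//; nra.
move: `|x - y| (normr_ge0 (x - y)) => r; rewrite le_eqVlt => /predU1P[<- _|r0 r2].
  by rewrite mulr_ge0// powR_ge0.
have [r1|/ltW r1] := leP r 1.
  rewrite (le_trans (ger1_powR _ beta_le1)) ?r0//.
  by rewrite ler_peMl ?powR_ge0// ler1n.
apply: le_trans r2 _; rewrite -[leLHS]mulr1 ler_wpM2l// -(powRr0 r).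
by apply: ler_powR => //; exact: ltW.
Qed.

Lemma holder_class_cont k f : holder_class beta k f -> cont_closed_disk f.
Proof. by case: k => [|k] /= => [[]//|fd]; have [g []] := fd 0. Qed.

(** The base case is that C^1 implies Lipschitz, hence Hoelder. The product rule relies on this
    lemma, because it pairs a derivative with an undifferentiated factor. *)
Lemma holder_class_le k f : holder_class beta k.+1 f -> holder_class beta k f.
Proof.
elim: k f => [|k IH] f fd.
  split; first exact: holder_class_cont fd.
  have /choice[g fg] : forall i, exists g : R * R -> R, is_pderiv i f g.
    by move=> i; have [g fg _] := fd i; exists g.
  have [C C0 fC] := is_pderiv_lipschitz fg.
  exists (C * 2) => x y Dx Dy; apply: le_trans (fC x y Dx Dy) _.
  by rewrite -mulrA ler_wpM2l// ler_powR_closed_disk.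
by move=> i; have [g fg /IH hg] := fd i; exists g.
Qed.

Lemma holder_classD k f g : holder_class beta k f -> holder_class beta k g ->
  holder_class beta k (fun z => f z + g z).
Proof.
elim: k f g => [|k IH] f g.
  move=> [cf [C fC]] [cg [C' gC]]; split; first exact: cont_closed_diskD.
  exists (C + C') => x y Dx Dy; rewrite opprD addrACA mulrDl.
  by apply: le_trans (ler_normD _ _) _; apply: lerD; [exact: fC|exact: gC].
move=> fd gd i; have [f' ff' hf'] := fd i; have [g' gg' hg'] := gd i.
exists (fun z => f' z + g' z); first exact: is_pderivD.
exact: IH.
Qed.

Lemma holder_classM k f g : holder_class beta k f -> holder_class beta k g ->
  holder_class beta k (fun z => f z * g z).
Proof.
elim: k f g => [|k IH] f g.
  move=> [cf [C fC]] [cg [C' gC]]; split; first exact: cont_closed_diskM.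
  have [M M0 fM] := cont_closed_disk_bounded cf.
  have [M' M'0 gM] := cont_closed_disk_bounded cg.
  exists (`|C| * M' + M * `|C'|) => x y Dx Dy.
  rewrite (_ : _ - _ = (f x - f y) * g x + f y * (g x - g y)); last by ring.
  rewrite [leRHS]mulrDl [X in _ <= X + _]mulrAC -[M * _ * _]mulrA.
  apply: le_trans (ler_normD _ _) _; rewrite !normrM; apply: lerD.
    apply: ler_pM => //; last exact: gM.
    apply: le_trans (fC x y Dx Dy) _.
    by rewrite ler_wpM2r ?powR_ge0// ler_norm.
  apply: ler_pM => //; first exact: fM.
  apply: le_trans (gC x y Dx Dy) _.
  by rewrite ler_wpM2r ?powR_ge0// ler_norm.
move=> fd gd i; have [f' ff' hf'] := fd i; have [g' gg' hg'] := gd i.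
exists (fun z => f' z * g z + f z * g' z); first exact: is_pderivM.
by apply: holder_classD; apply: IH => //; exact: holder_class_le.
Qed.

Lemma holder_class_cst k (c : R) : holder_class beta k (fun=> c).
Proof.
elim: k c => [|k IH] c.
  split; first exact/continuous_cont_closed_disk/cst_continuous.
  by exists 0 => x y _ _; rewrite subrr normr0 mul0r.
by move=> i; exists (fun=> 0); [exact: is_pderiv_cst|exact: IH].
Qed.

Lemma holder_class_coord2 k i : holder_class beta k (@coord2 R i).
Proof.
(* One order higher there is always a derivative to take, and it is constant. *)
apply: holder_class_le => j; exists (fun=> (j == i)%:R).
  exact: is_pderiv_coord2.
exact: holder_class_cst.
Qed.

Lemma holder_class_sum (I : finType) k (F : I -> R * R -> R) :
  (forall j, holder_class beta k (F j)) ->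
  holder_class beta k (fun z => \sum_j F j z).
Proof.
move=> hF; elim: (index_enum I) => [|j s IH].
  by under eq_fun do rewrite big_nil; exact: holder_class_cst.
by under eq_fun do rewrite big_cons; exact: holder_classD.
Qed.

Lemma holder_classX k f n : holder_class beta k f ->
  holder_class beta k (fun z => f z ^+ n).
Proof.
move=> hf; elim: n => [|n IH].
  by under eq_fun do rewrite expr0; exact: holder_class_cst.
by under eq_fun do rewrite exprS; exact: holder_classM.
Qed.

Lemma holder_classN k f : holder_class beta k f ->
  holder_class beta k (fun z => - f z).
Proof.
move=> hf; under eq_fun do rewrite -mulN1r.
by apply: holder_classM => //; exact: holder_class_cst.
Qed.

(** By the mean value theorem [u] is 1-Lipschitz and keeps the Hoelder constant. This is the order 0
    case for sine and cosine. *)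
Lemma holder_class_lip (u u' : R -> R) f :
  (forall x : R, is_derive x 1 u (u' x)) -> (forall x, `|u' x| <= 1) ->
  holder_class beta 0 f -> holder_class beta 0 (fun z => u (f z)).
Proof.
move=> uu' u'1 [cf [C fC]].
have cu : continuous u.
  move=> x; apply: differentiable_continuous; apply/derivable1_diffP.
  by have [] := uu' x.
split; first exact: cont_closed_disk_comp cf.
exists C => x y Dx Dy; apply: le_trans (fC x y Dx Dy).
move: (f x) (f y) => a b; wlog ab : a b / b <= a => [wl|].
  case: (leP b a) => [|/ltW] ba; first exact: wl.
  by rewrite distrC [leRHS]distrC; exact: wl.
have [|c _ ->] := MVT_segment ab (fun x _ => uu' x).
  exact: continuous_subspaceT.
by rewrite normrM ler_piMl.
Qed.

(** Joint induction, because differentiating either function produces the other. *)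
Lemma holder_class_cos_sin k f : holder_class beta k f ->
  holder_class beta k (fun z => cos (f z)) /\
  holder_class beta k (fun z => sin (f z)).
Proof.
elim: k f => [|k IH] f.
  move=> hf; split.
    apply: (holder_class_lip (u' := fun x => - sin x)) => // x.
    by rewrite normrN ler_norml sin_geN1 sin_le1.
  apply: (holder_class_lip (u' := cos)) => // x.
  by rewrite ler_norml cos_geN1 cos_le1.
move=> fd; have [hcos hsin] := IH f (holder_class_le fd).
split=> i; have [g fg hg] := fd i.
  exists (fun z => - sin (f z) * g z).
    apply: (is_pderiv_comp (u' := fun x => - sin x)) fg => x.
    by apply: continuousN; exact: continuous_sin.
  by apply: holder_classM => //; exact: holder_classN.
exists (fun z => cos (f z) * g z).
  by apply: (is_pderiv_comp (u' := cos)) fg; exact: continuous_cos.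
exact: holder_classM.
Qed.

End holder_algebra.

(** * Inner products and product rules for vector-valued maps *)

Section inner_product.
Context {R : realType} {n : nat}.
Implicit Types x y w : 'rV[R]_n.

Lemma dotvC x y : dotv x y = dotv y x.
Proof. by apply: eq_bigr => j _; rewrite mulrC. Qed.

Lemma dotvDl x y w : dotv (x + y) w = dotv x w + dotv y w.
Proof. by rewrite -big_split; apply: eq_bigr => j _; rewrite mxE mulrDl. Qed.

Lemma dotvZl c x y : dotv (c *: x) y = c * dotv x y.
Proof. by rewrite mulr_sumr; apply: eq_bigr => j _; rewrite mxE mulrA. Qed.

Lemma dotvDr x y w : dotv w (x + y) = dotv w x + dotv w y.
Proof. by rewrite ![dotv w _]dotvC dotvDl. Qed.

Lemma dotvZr c x y : dotv y (c *: x) = c * dotv y x.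
Proof. by rewrite ![dotv y _]dotvC dotvZl. Qed.

Lemma is_pderiv_sum (I : finType) i (F G : I -> R * R -> R) :
  (forall j, is_pderiv i (F j) (G j)) ->
  is_pderiv i (fun z => \sum_j F j z) (fun z => \sum_j G j z).
Proof.
move=> FG; elim: (index_enum I) => [|j s IH].
  by under eq_fun do rewrite big_nil; under [X in is_pderiv _ _ X]eq_fun do
    rewrite big_nil; exact: is_pderiv_cst.
under eq_fun do rewrite big_cons; under [X in is_pderiv _ _ X]eq_fun do
  rewrite big_cons.
exact: is_pderivD.
Qed.

Lemma is_pderiv_dotv i (f g f' g' : R * R -> 'rV[R]_n) :
  is_pderiv i f f' -> is_pderiv i g g' ->
  is_pderiv i (fun z => dotv (f z) (g z))
    (fun z => dotv (f' z) (g z) + dotv (f z) (g' z)).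
Proof.
move=> /is_pderiv_rV ff' /is_pderiv_rV gg'.
under [X in is_pderiv _ _ X]eq_fun do rewrite /dotv -big_split /=.
by apply: is_pderiv_sum => j; apply: is_pderivM.
Qed.

Lemma is_pderiv_scale i (a a' : R * R -> R) (f f' : R * R -> 'rV[R]_n) :
  is_pderiv i a a' -> is_pderiv i f f' ->
  is_pderiv i (fun z => a z *: f z) (fun z => a' z *: f z + a z *: f' z).
Proof.
move=> aa' /is_pderiv_rV ff'; apply/is_pderiv_rV => j.
by apply: is_pderiv_ext (is_pderivM aa' (ff' j)) => z _; rewrite !mxE.
Qed.

Lemma is_pderiv_add i (f g f' g' : R * R -> 'rV[R]_n) :
  is_pderiv i f f' -> is_pderiv i g g' ->
  is_pderiv i (fun z => f z + g z) (fun z => f' z + g' z).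
Proof.
move=> /is_pderiv_rV ff' /is_pderiv_rV gg'; apply/is_pderiv_rV => j.
by apply: is_pderiv_ext (is_pderivD (ff' j) (gg' j)) => z _; rewrite !mxE.
Qed.

End inner_product.

(** * Rotations of orthonormal and normal frames *)

Section rotated_frames.
Context {R : realType}.
Implicit Types (N : 'I_2 -> R * R -> 'rV[R]_4) (phi : R * R -> R) (z : R * R).

Definition orthonormal_frame N := forall z, closed_disk R z ->
  forall sigma theta, dotv (N sigma z) (N theta z) = (sigma == theta)%:R.

Definition C1_frame N :=
  forall sigma i, is_pderiv i (N sigma) (pderiv i (N sigma)).

(** Differentiate the constant function [dotv (N sigma w) (N theta w)]. *)
Lemma torsion_antisym N i sigma theta z : orthonormal_frame N -> C1_frame N ->
  closed_disk R z -> torsion N sigma i theta z = - torsion N theta i sigma z.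
Proof.
move=> oN dN Dz; apply/eqP; rewrite -addr_eq0 /torsion [X in _ + X]dotvC.
have dE := is_pderiv_dotv (dN sigma i) (dN theta i).
rewrite -(pderivE dE Dz).
rewrite (pderivE (g := fun=> 0) _ Dz)//.
apply: is_pderiv_ext (is_pderiv_cst i (sigma == theta)%:R) => // w Dw.
by rewrite oN.
Qed.

(** Diagonal torsions vanish and the two off-diagonal ones are opposite, so all terms collect into
    cos^2 + sin^2 times the right-hand side. *)
Lemma torsion_rotate_frame N phi phi' i z :
  orthonormal_frame N -> C1_frame N -> is_pderiv i phi phi' ->
  closed_disk R z ->
  torsion (rotate_frame phi N) 0 i 1 z = torsion N 0 i 1 z + phi' z.
Proof.
move=> oN dN dphi Dz.
have dcos := is_pderiv_comp (@is_derive_cos R)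
  (fun x => continuousN (@continuous_sin R x)) dphi.
have dsin := is_pderiv_comp (@is_derive_sin R) (@continuous_cos R) dphi.
have dR := is_pderiv_add (is_pderiv_scale dcos (dN 0 i))
  (is_pderiv_scale dsin (dN 1 i)).
rewrite {1}/torsion (pderivE dR Dz) /rotate_frame /=.
have T0 sigma : torsion N sigma i sigma z = 0.
  by have := torsion_antisym i sigma sigma oN dN Dz; lra.
have := (T0 0, T0 1, torsion_antisym i 1 0 oN dN Dz).
have := (oN z Dz 0 0, oN z Dz 1 1, oN z Dz 0 1, oN z Dz 1 0) => /=.
have := cos2Dsin2 (phi z); rewrite /torsion.
move: (cos (phi z)) (sin (phi z)) => c s.
move: (pderiv i (N 0) z) (pderiv i (N 1) z) (N 0 z) (N 1 z) => A' B' A B cs.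
move=> [[[AA BB] AB] BA] [[A'A B'B] B'A].
rewrite !(dotvDl, dotvDr, dotvZl, dotvZr) AA BB AB BA A'A B'B B'A.
transitivity ((c ^+ 2 + s ^+ 2) * (dotv A' B + phi' z)); first by ring.
by rewrite cs mul1r.
Qed.

Lemma orthonormal_rotate_frame N phi :
  orthonormal_frame N -> orthonormal_frame (rotate_frame phi N).
Proof.
move=> oN z Dz sigma theta; have := cos2Dsin2 (phi z).
have := (oN z Dz 0 0, oN z Dz 1 1, oN z Dz 0 1, oN z Dz 1 0) => /=.
rewrite /rotate_frame; move: (N 0 z) (N 1 z) => a b [[[aa bb] ab] ba] E.
by case: (ord2P sigma) => ->; case: (ord2P theta) => -> /=;
  rewrite !(dotvDl, dotvDr, dotvZl, dotvZr) aa bb ab ba; lra.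
Qed.

(** Rotating the last two rows is multiplication on the left by a block diagonal matrix of
    determinant 1. *)
Lemma det_rotate_frame (x y a b : 'rV[R]_4) (c s : R) : c ^+ 2 + s ^+ 2 = 1 ->
  \det (\matrix_(r < 4) nth 0 [:: x; y; c *: a + s *: b; - s *: a + c *: b] r) =
  \det (\matrix_(r < 4) nth 0 [:: x; y; a; b] r).
Proof.
move=> cs.
have split4 (x' y' a' b' : 'rV[R]_4) :
    \matrix_(r < 4) nth 0 [:: x'; y'; a'; b'] r =
    col_mx (\matrix_(r < 2) nth 0 [:: x'; y'] r)
           (\matrix_(r < 2) nth 0 [:: a'; b'] r) :> 'M[R]_(2 + 2, 4).
  apply/matrixP => i j; rewrite -[i]fintype.splitK; case: (fintype.split i) => k;
    rewrite /= ?col_mxEu ?col_mxEd !mxE.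
    by case: (ord2P k) => ->.
  by case: (ord2P k) => ->.
pose rot : 'M[R]_2 := \matrix_(i, j)
  (if i == 0 then if j == 0 then c else s else if j == 0 then - s else c).
have detrot : \det rot = 1.
  rewrite (expand_det_row _ 0) !big_ord_recl big_ord0 /cofactor !det_mx11 !mxE /=.
  by rewrite -[RHS]cs /bump /=; ring.
rewrite !split4.
pose P := (\matrix_(r < 2) nth 0 [:: x; y] r).
pose Q := (\matrix_(r < 2) nth 0 [:: a; b] r).
have -> : col_mx P (\matrix_(r < 2)
      nth 0 [:: c *: a + s *: b; - s *: a + c *: b] r) =
    block_mx 1%:M 0 0 rot *m (col_mx P Q : 'M[R]_(2 + 2, 4)).
  rewrite mul_block_col mul1mx !mul0mx addr0 add0r; congr col_mx.
  apply/row_matrixP => k; rewrite row_mul; apply/rowP => j.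
  rewrite !mxE !big_ord_recl big_ord0 addr0 !mxE.
  by case: (ord2P k) => -> /=; rewrite !mxE.
rewrite -/P -/Q.
rewrite (det_mulmx (block_mx (1%:M : 'M[R]_2) 0 0 rot)).
by rewrite det_ublock det1 detrot !mul1r.
Qed.

Lemma normal_frame_rotate_frame k beta X N phi :
  0 < beta -> beta <= 1 ->
  normal_frame k beta X N -> Ckb_closed_disk k.-1 beta phi ->
  normal_frame k beta X (rotate_frame phi N).
Proof.
move=> b0 b1 [hN frN] /Ckb_closed_diskP hphi; split.
  have hNj sigma j : holder_class beta k.-1 (fun z => N sigma z 0 j).
    by move: j; apply/holder_class_rV; apply/Ckb_closed_diskP.
  have [hc hs] := holder_class_cos_sin b0 b1 hphi.
  move=> sigma; apply/Ckb_closed_diskP/holder_class_rV => j.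
  have [->|->] := ord2P sigma.
    apply: (@holder_class_ext _ _ _ _
      (fun z => cos (phi z) * N 0 z 0 j + sin (phi z) * N 1 z 0 j)) => [z _|].
      by rewrite /rotate_frame /= !mxE.
    by apply: holder_classD; apply: holder_classM.
  apply: (@holder_class_ext _ _ _ _
    (fun z => - sin (phi z) * N 0 z 0 j + cos (phi z) * N 1 z 0 j)) => [z _|].
    by rewrite /rotate_frame /= !mxE.
  by apply: holder_classD; apply: holder_classM => //; exact: holder_classN.
move=> z Dz; have [oN tN dN] := frN z Dz; split.
- apply: orthonormal_rotate_frame => // w Dw.
  by have [] := frN w Dw.
- move=> sigma i; rewrite /rotate_frame; case: ifP => _.
    by rewrite dotvDl !dotvZl !tN !mulr0 addr0.
  by rewrite dotvDl !dotvZl !tN !mulr0 addr0.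
- by rewrite /rotate_frame /= det_rotate_frame// cos2Dsin2.
Qed.

Lemma normal_frame_ext k beta X N N' :
  (forall sigma z, closed_disk R z -> N sigma z = N' sigma z) ->
  normal_frame k beta X N -> normal_frame k beta X N'.
Proof.
move=> NN' [hN frN]; split.
  move=> sigma; apply/Ckb_closed_diskP.
  by apply: holder_class_ext (NN' sigma) _; apply/Ckb_closed_diskP.
move=> z Dz; have [oN tN dN] := frN z Dz; split.
- by move=> sigma theta; rewrite -!NN'.
- by move=> sigma i; rewrite -NN'.
- by rewrite -!NN'.
Qed.

(** Allows a frame that is given only through its rotation to be recovered by the opposite angle. *)
Lemma rotate_frameK N phi sigma z :
  rotate_frame (fun w => - phi w) (rotate_frame phi N) sigma z = N sigma z.
Proof.
rewrite /rotate_frame cosN sinN; have := cos2Dsin2 (phi z).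
move: (cos (phi z)) (sin (phi z)) => c s E.
have [->|->] := ord2P sigma; apply/rowP => j; rewrite /= !mxE.
  transitivity ((c ^+ 2 + s ^+ 2) * N 0 z 0 j); first by ring.
  by rewrite E mul1r.
transitivity ((c ^+ 2 + s ^+ 2) * N 1 z 0 j); first by ring.
by rewrite E mul1r.
Qed.

End rotated_frames.

(** * Measure and integration on the disk *)

Section disk_integral.
Context {R : realType}.
Local Notation leb := (@lebesgue_measure R).
Local Notation mu2 := (@lebesgue_measure R \x @lebesgue_measure R)%E.
Local Notation T2 := (measurableTypeR R * measurableTypeR R)%type.
Implicit Types (f g h : R * R -> R) (z : R * R).

(** Links the topology of the plane to the product sigma-algebra: an open set is a countable union
    of boxes with rational centres and half-widths. Indices whose box leaves the set contribute the
    empty set. *)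
Lemma open_measurable_prod (A : set (R * R)) : open A -> measurable (A : set T2).
Proof.
move=> oA.
pose box (p : rat * rat * rat) : set (R * R) :=
  `](ratr p.1.1 - ratr p.2), (ratr p.1.1 + ratr p.2)[ `*`
  `](ratr p.1.2 - ratr p.2), (ratr p.1.2 + ratr p.2)[.
rewrite [A](_ : _ = \bigcup_p (if `[< box p `<=` A >] then box p else set0)).
  apply: countable_bigcupT_measurable => // p; case: ifPn => // _.
  by apply: measurableX; exact: measurable_itv.
apply/seteqP; split => [[a b] Aab|z [p _]]; last first.
  by case: ifPn => // /asboolP; exact.
have /= [e /= e0 eA] : nbhs_ball (a, b) A.
  by apply/nbhs_ballP; exact: open_nbhs_nbhs.
have e20 : 0 < e / 2 by rewrite divr_gt0.
(* Two points of a box of half-width r differ by less than 2 r < e in each coordinate, so a box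
   around (a, b) stays in the e-ball. *)
have [r /[!in_itv]/= /andP[r0 re]] := rat_in_itvoo e20.
have near_rat (x : R) : exists q : rat, ratr q - ratr r < x < ratr q + ratr r.
  have [|q] := @rat_in_itvoo R (x - ratr r) (x + ratr r); first by lra.
  by rewrite in_itv/= => /andP[? ?]; exists q; apply/andP; split; lra.
have [p pa] := near_rat a; have [q qb] := near_rat b.
exists ((p, q), r) => //; case: ifPn => [_|/asboolPn[]].
  by split; rewrite /= in_itv/=.
move=> [x y] [] /=; rewrite !in_itv/= => /andP[x1 x2] /andP[y1 y2].
move: pa qb => /andP[? ?] /andP[? ?].
by apply: eA; split; rewrite /ball/= ltr_norml; apply/andP; split; lra.
Qed.

Lemma open_disk_preimage f (U : set R) : cont_closed_disk f -> open U ->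
  open (disk R `&` f @^-1` U).
Proof.
move=> cf oU; rewrite openE => z [Dz Uz].
have fz := cont_closed_disk_lim cf (disk_closed_disk Dz).
rewrite within_disk// in fz.
rewrite /interior; apply: filterI; first exact: near_disk.
by apply: fz; exact: open_nbhs_nbhs.
Qed.

Lemma measurable_disk : measurable (disk R : set T2).
Proof. apply: open_measurable_prod; exact: open_disk. Qed.

(** Within the open disk, preimages of open sets are open in the plane, hence measurable. *)
Lemma measurable_fun_disk f : cont_closed_disk f ->
  measurable_fun (disk R : set T2) f.
Proof.
move=> cf; apply: (measurability _ (RGenOpens.measurableE R)).
move=> _ [_ [a [b ->] <-]]; apply: open_measurable_prod.
exact: open_disk_preimage.
Qed.

Lemma mu2_box (a b c d : R) : a < b -> c < d ->
  mu2 (`]a, b[ `*` `]c, d[) = ((b - a) * (d - c))%:E.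
Proof.
move=> ab cd; rewrite product_measure1E; [|exact: measurable_itv..].
have leb_itv (x y : R) : x < y -> leb `]x, y[ = (y - x)%:E.
  by move=> xy; rewrite lebesgue_measure_itv/= lte_fin xy -EFinB.
by rewrite EFinM; congr (_ * _)%E; exact: leb_itv.
Qed.

Lemma mu2_disk_lty : (mu2 (disk R) < +oo)%E.
Proof.
apply: (@le_lt_trans _ _ (mu2 (`]-2, 2[ `*` `]-2, 2[))).
  apply: le_measure; rewrite ?inE; first exact: measurable_disk.
    by apply: measurableX; exact: measurable_itv.
  move=> [a b]; rewrite /disk/= => ab; split; rewrite /= in_itv/=;
    by apply/andP; split; nra.
by rewrite mu2_box ?ltry// ltrNl; lra.
Qed.

Lemma mu2_open_gt0 (A : set (R * R)) : open A -> A !=set0 -> (0 < mu2 A)%E.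
Proof.
move=> oA [[a b] Aab].
have /= [e /= e0 eA] : nbhs_ball (a, b) A.
  by apply/nbhs_ballP; exact: open_nbhs_nbhs.
apply: (@lt_le_trans _ _ (mu2 (`]a - e, a + e[ `*` `]b - e, b + e[))).
  rewrite mu2_box; [|lra..].
  by rewrite lte_fin mulr_gt0//; lra.
apply: le_measure; rewrite ?inE; last 2 first.
- exact: open_measurable_prod.
- move=> [x y] [] /=; rewrite !in_itv/= => /andP[x1 x2] /andP[y1 y2].
  by apply: eA; split; rewrite /ball/= ltr_norml; apply/andP; split; lra.
by apply: measurableX; exact: measurable_itv.
Qed.

Lemma integrable_disk f : cont_closed_disk f ->
  mu2.-integrable (disk R : set T2) (EFin \o f).
Proof.
move=> cf; apply: measurable_bounded_integrable.
- exact: measurable_disk.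
- exact: mu2_disk_lty.
- exact: measurable_fun_disk.
have [M _ fM] := cont_closed_disk_bounded cf.
exists M; split; first exact: num_real.
by move=> x Mx z Dz; apply: le_trans (ltW Mx); exact/fM/disk_closed_disk.
Qed.

Definition disk_int f : R := \int[mu2]_(z in disk R) f z.

Lemma eq_disk_int f g : (forall z, disk R z -> f z = g z) ->
  disk_int f = disk_int g.
Proof. by move=> fg; apply: eq_Rintegral => z /set_mem; exact: fg. Qed.

Lemma disk_intD f g : cont_closed_disk f -> cont_closed_disk g ->
  disk_int (fun z => f z + g z) = disk_int f + disk_int g.
Proof.
move=> cf cg; apply: RintegralD; first exact: measurable_disk.
- exact: integrable_disk.
- exact: integrable_disk.
Qed.

Lemma disk_intZ c f : cont_closed_disk f ->
  disk_int (fun z => c * f z) = c * disk_int f.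
Proof.
by move=> cf; apply: RintegralZl; [exact: measurable_disk|exact: integrable_disk].
Qed.

End disk_integral.

(** * Integration by parts for functions vanishing on the circle *)

Section integration_by_parts.
Context {R : realType}.
Local Notation leb := (@lebesgue_measure R).
Local Notation mu2 := (@lebesgue_measure R \x @lebesgue_measure R)%E.
Local Notation T2 := (measurableTypeR R * measurableTypeR R)%type.
Implicit Types (f g F G : R * R -> R) (z : R * R).

Lemma sum_ord2 (F : 'I_2 -> R) : \sum_(i < 2) F i = F 0 + F 1.
Proof.
rewrite !big_ord_recl big_ord0 addr0; congr (_ + F _); exact: val_inj.
Qed.

Definition line_point (i : 'I_2) (s t : R) : R * R :=
  if i == 0 then (t, s) else (s, t).

Lemma line_pointE i s t :
  line_point i s t = t *: basis_vec R i + line_point i s 0.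
Proof.
by case: (ord2P i) => ->; rewrite /line_point /= /basis_vec /=; congr pair => /=;
  rewrite /GRing.scale/= ?mulr1 ?mulr0 ?addr0 ?add0r.
Qed.

(** The line either misses the open disk or meets it in ]-a, a[ with a = sqrt (1 - s^2). In the
    latter case the integral is the difference of [F] at two points of the circle. *)
Lemma integral_slice i F G (s : R) : is_pderiv i F G ->
  (forall z, unit_circle R z -> F z = 0) ->
  (\int[leb]_t (((EFin \o G) \_ (disk R)) (line_point i s t)) = 0)%E.
Proof.
move=> [cF cG FG] F0; set P := line_point i s.
have sqn t : (P t).1 ^+ 2 + (P t).2 ^+ 2 = t ^+ 2 + s ^+ 2.
  by rewrite /P /line_point; case: ifP => //=; rewrite addrC.
have PE : P = fun t => t *: basis_vec R i + P 0.
  by apply/funext => t; exact: line_pointE.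
have cP : continuous P by rewrite PE; exact: continuous_line.
have [s1|s1] := leP 1 (s ^+ 2).
  apply: integral0_eq => t _; rewrite patchE; case: ifPn => // /set_mem DPt.
  by exfalso; move: DPt; rewrite /disk/= sqn; have := sqr_ge0 t; lra.
pose a := Num.sqrt (1 - s ^+ 2).
have a0 : 0 < a by rewrite sqrtr_gt0 subr_gt0.
have a2 : a ^+ 2 = 1 - s ^+ 2 by rewrite sqr_sqrtr// subr_ge0 ltW.
have Dt t : t \in `]-a, a[ -> disk R (P t).
  by rewrite in_itv/= => /andP[t1 t2]; rewrite /disk/= sqn; nra.
have DtP t : disk R (P t) -> t \in `]-a, a[.
  by rewrite /disk/= sqn in_itv/= => t1; apply/andP; split; nra.
have cDt t : t \in `[-a, a] -> closed_disk R (P t).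
  by rewrite in_itv/= => /andP[t1 t2]; rewrite /closed_disk/= sqn; nra.
have path f : cont_closed_disk f ->
    {within `[-a, a], continuous (fun t => f (P t))}.
  move=> cf; apply: (cont_closed_disk_path (gam := P)) cf.
    exact: cP.
  by move=> t; exact: cDt.
transitivity (\int[leb]_(t in `](- a)%R, a[) (G (P t))%:E)%E.
  rewrite [RHS]integral_mkcond; apply: eq_integral => t _; rewrite !patchE.
  case: ifPn => [/set_mem tD|tD].
    by rewrite ifT// inE; exact: DtP.
  by rewrite ifF//; apply: contraNF tD; rewrite !inE; exact: Dt.
have dP t : t \in `]-a, a[ -> is_derive t 1 (fun t => F (P t)) (G (P t)).
  by move=> /Dt /FG; rewrite PE => dF; exact/is_derive_slice.
have mG : measurable_fun `[- a, a] (EFin \o (fun t => G (P t))).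
  apply/measurable_EFinP; apply: subspace_continuous_measurable_fun => //.
  exact: path.
have sub_itv b : [set` Interval (BRight (- a)) (BSide b a)] `<=` `[- a, a].
  by apply: subset_itv; rewrite bnd_simp//; case: b.
(* Endpoints are null sets; the closed interval is the one on which the fundamental theorem of
   calculus applies. *)
rewrite integral_itv_bndo_bndc ?integral_itv_obnd_cbnd//; last 2 first.
- exact: measurable_funS (sub_itv _) mG.
- exact: measurable_funS (sub_itv _) mG.
rewrite (@continuous_FTC2 _ _ (fun t => F (P t))).
- have onC t : t ^+ 2 = a ^+ 2 -> F (P t) = 0.
    by move=> ta; apply: F0; rewrite /unit_circle/= sqn ta a2 subrK.
  by rewrite !onC ?sqrrN ?subee.
- by rewrite gtrN.
- exact: path.
- have /continuous_within_itvP := path F cF; rewrite gtrN// => /(_ isT)[_ ? ?].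
  by split=> // t /dP[].
- by move=> t /dP[_ <-]; rewrite derive1E.
Qed.

(** By Fubini, integrate first in direction [i]; the two values of [i] differ in the order of the
    iterated integrals. *)
Lemma disk_int_pderiv i F G : is_pderiv i F G ->
  (forall z, unit_circle R z -> F z = 0) -> disk_int G = 0.
Proof.
move=> FG F0; have [_ cG _] := FG.
rewrite /disk_int /Rintegral integral_mkcond.
have iG : mu2.-integrable [set: T2] ((EFin \o G) \_ (disk R)).
  exact: (integrable_mkcond _ measurable_disk).1 (integrable_disk cG).
case: (ord2P i) FG => -> FG.
  rewrite -integral21_prod_meas1// integral0_eq// => y _.
  exact: (integral_slice y FG F0).
rewrite -integral12_prod_meas1// integral0_eq// => x _.
exact: (integral_slice x FG F0).
Qed.

Lemma cont_closed_disk_sum2 (F : 'I_2 -> R * R -> R) :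
  (forall i, cont_closed_disk (F i)) ->
  cont_closed_disk (fun z => \sum_(i < 2) F i z).
Proof.
move=> cF; under eq_fun do rewrite sum_ord2.
exact: cont_closed_diskD.
Qed.

(** Each product T_i f vanishes on the circle, so its i-th derivative integrates to 0; sum over
    i. *)
Lemma disk_int_by_parts (T dT chi : 'I_2 -> R * R -> R) f :
  (forall i, is_pderiv i (T i) (dT i)) ->
  (forall i, is_pderiv i f (chi i)) ->
  (forall z, unit_circle R z -> f z = 0) ->
  disk_int (fun z => \sum_(i < 2) T i z * chi i z) =
  - disk_int (fun z => (\sum_(i < 2) dT i z) * f z).
Proof.
move=> dTi dfi f0.
have part i : disk_int (fun z => dT i z * f z + T i z * chi i z) = 0.
  apply: (disk_int_pderiv (is_pderivM (dTi i) (dfi i))) => z /f0 ->.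
  by rewrite mulr0.
have cT i : cont_closed_disk (T i) by have [] := dTi i.
have cdT i : cont_closed_disk (dT i) by have [] := dTi i.
have cchi i : cont_closed_disk (chi i) by have [] := dfi i.
have cf : cont_closed_disk f by have [] := dfi 0.
apply/eqP; rewrite -addr_eq0 -disk_intD; last 2 first.
- by apply: cont_closed_disk_sum2 => i; exact: cont_closed_diskM.
- by apply: cont_closed_diskM => //; exact: cont_closed_disk_sum2.
have := congr2 +%R (part 0) (part 1); rewrite addr0 -disk_intD; last 2 first.
- by apply: cont_closed_diskD; exact: cont_closed_diskM.
- by apply: cont_closed_diskD; exact: cont_closed_diskM.
move=> sum0; apply/eqP; rewrite -[RHS]sum0; apply: eq_disk_int => z _ /=.
by rewrite !sum_ord2; ring.
Qed.

End integration_by_parts.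

(** * Concentration of powers of a peak function *)

Section concentration.
Context {R : realType}.
Local Notation mu2 := (@lebesgue_measure R \x @lebesgue_measure R)%E.
Implicit Types (f K : R * R -> R) (z : R * R).

Lemma cont_closed_diskX f n : cont_closed_disk f ->
  cont_closed_disk (fun z => f z ^+ n).
Proof. by move=> cf; apply: (cont_closed_disk_comp (@exprn_continuous R n) cf). Qed.

Lemma cont_closed_disk_cst (c : R) : cont_closed_disk (fun=> c : R).
Proof. exact/continuous_cont_closed_disk/cst_continuous. Qed.

(** Suppose f(z0) > 0, so that f >= c > 0 near z0. Where K <= q < 1 the integrand is at least - M
    q^n, while a set V on which K > q' > q contributes at least c q'^n times its measure. For large
    n the integral cannot be 0. *)
Lemma concentration_le f K z0 : cont_closed_disk f -> cont_closed_disk K ->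
  closed_disk R z0 -> K z0 = 1 ->
  (forall z, closed_disk R z ->
    0 <= K z <= 1 - ((z.1 - z0.1) ^+ 2 + (z.2 - z0.2) ^+ 2) / 4) ->
  (forall n, disk_int (fun z => K z ^+ n * f z) = 0) ->
  f z0 <= 0.
Proof.
move=> cf cK Dz0 Kz0 K01 int0; rewrite leNgt; apply/negP => fz0.
pose c := f z0 / 2; have c0 : 0 < c by rewrite divr_gt0.
have [e e0 fe] : exists2 e, 0 < e & forall z, closed_disk R z ->
    `|z0.1 - z.1| < e -> `|z0.2 - z.2| < e -> c <= f z.
  have /cont_closed_diskP/(_ z0 Dz0)/cvgrPdist_lt/(_ c c0) := cf.
  rewrite near_withinE => /nbhs_ballP[e /= e0 fe]; exists e => // z Dz ez1 ez2.
  have := fe z (conj ez1 ez2) Dz; rewrite ltr_norml => /andP[_].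
  by rewrite /c; lra.
have [M M0 fM] := cont_closed_disk_bounded cf.
(* The hypothesis on K gives K <= 1 - e^2 / 4 at distance at least e from z0; the maximum with 0
   makes q a nonnegative base for powers. *)
pose q := Num.max 0 (1 - e ^+ 2 / 4).
have q0 : 0 <= q by rewrite le_max lexx.
have q1 : q < 1 by rewrite gt_max ltr01/= gtrBl divr_gt0// exprn_gt0.
pose q' := (1 + q) / 2.
have qq' : q < q' by rewrite /q'; lra.
have q'1 : q' < 1 by rewrite /q'; lra.
have q'0 : 0 < q' by exact: le_lt_trans qq'.
have K_far z : closed_disk R z -> q < K z -> c <= f z.
  move=> Dz qK; have /andP[_ Kz] := K01 z Dz.
  have {Kz}: (z.1 - z0.1) ^+ 2 + (z.2 - z0.2) ^+ 2 < e ^+ 2.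
    have : 1 - e ^+ 2 / 4 < K z by apply: le_lt_trans qK; rewrite le_max lexx orbT.
    by lra.
  have lt_e (x : R) : x ^+ 2 < e ^+ 2 -> `|x| < e.
    by rewrite -(real_normK (num_real x)) ltr_sqr ?nnegrE// ltW.
  have := sqr_ge0 (z.1 - z0.1); have := sqr_ge0 (z.2 - z0.2) => ? ? ?.
  by apply: fe => //; rewrite distrC; apply: lt_e; lra.
pose V := disk R `&` K @^-1` [set x | q' < x].
have oV : open V by apply: open_disk_preimage => //; exact: open_gt.
(* V is nonempty even if z0 is on the circle, since K tends to 1 at z0 along the open disk. *)
have V_gt0 : (0 < mu2 V)%E.
  apply: mu2_open_gt0 => //.
  have := cont_closed_disk_lim cK Dz0; have Pz0 := within_disk_proper Dz0.
  move=> /cvgrPdist_lt/(_ (1 - q')); rewrite subr_gt0 => /(_ q'1) KV.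
  have DV : \forall z \near within (disk R) (nbhs z0), disk R z.
    by rewrite near_withinE; exact: nearW.
  have [z [Dz]] := @filter_ex _ _ Pz0 _ (filterI DV KV).
  by rewrite Kz0 ltr_norml => /andP[_ Kz]; exists z; split => //=; lra.
have V_lty : (mu2 V < +oo)%E.
  apply: le_lt_trans mu2_disk_lty; apply: le_measure; rewrite ?inE.
  - exact: open_measurable_prod.
  - exact: measurable_disk.
  - by move=> z [].
have [m mV m0] : exists2 m, mu2 V = m%:E & 0 < m.
  exists (fine (mu2 V)); first by rewrite fineK// ge0_fin_numE// ltW.
  by rewrite fine_gt0// V_gt0.
pose A := disk_int (fun=> 1 : R).
have main n : c * q' ^+ n * m <= M * q ^+ n * A.
  (* The added constant makes the integrand nonnegative, so restricting to V can only decrease the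
     integral. *)
  pose g z := K z ^+ n * f z + M * q ^+ n * 1.
  have cKf : cont_closed_disk (fun z => K z ^+ n * f z).
    by apply: cont_closed_diskM => //; exact: cont_closed_diskX.
  have cg : cont_closed_disk g.
    apply: cont_closed_diskD; first exact: cKf.
    exact: cont_closed_disk_cst.
  have g_int : disk_int g = M * q ^+ n * A.
    rewrite disk_intD ?int0 ?add0r.
    - by rewrite disk_intZ//; exact: cont_closed_disk_cst.
    - exact: cKf.
    - exact: cont_closed_disk_cst.
  have g_ge0 z : closed_disk R z -> 0 <= g z.
    move=> Dz; rewrite /g mulr1; have /andP[K0 _] := K01 z Dz.
    have [Kq|qK] := leP (K z) q; last first.
      rewrite addr_ge0// mulr_ge0 ?exprn_ge0// (le_trans (ltW c0))//.
      exact: K_far.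
    have : `|K z ^+ n * f z| <= M * q ^+ n.
      by rewrite normrM mulrC ler_pM// ?fM// ger0_norm ?exprn_ge0// lerXn2r.
    by rewrite ler_norml => /andP[+ _]; lra.
  have g_V z : V z -> c * q' ^+ n <= g z.
    move=> [/disk_closed_disk Dz /= Kz]; have /andP[K0 _] := K01 z Dz.
    rewrite /g mulr1 -[leLHS]addr0 lerD ?mulr_ge0 ?exprn_ge0//.
    rewrite mulrC ler_pM ?exprn_ge0 ?(ltW q'0) ?(ltW c0)//.
      by rewrite lerXn2r ?nnegrE ?(ltW q'0)// ltW.
    by apply: K_far => //; exact: lt_trans Kz.
  rewrite -g_int -lee_fin /disk_int /Rintegral fineK; last first.
    by apply: integrable_fin_num; [exact: measurable_disk|exact: integrable_disk].
  apply: (@le_trans _ _ (\int[mu2]_(z in V) (g z)%:E)%E); last first.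
    apply: ge0_subset_integral.
    - exact: open_measurable_prod.
    - exact: measurable_disk.
    - by apply/measurable_EFinP; exact: measurable_fun_disk.
    - by move=> z /disk_closed_disk/g_ge0; rewrite lee_fin.
    - by move=> z [].
  rewrite EFinM -mV -integral_cst; last exact: open_measurable_prod.
  apply: ge0_le_integral.
  - exact: open_measurable_prod.
  - by move=> z _; rewrite lee_fin mulr_ge0 ?exprn_ge0 ?(ltW q'0) ?(ltW c0).
  - exact: measurable_cst.
  - apply/measurable_EFinP; apply: measurable_funS (measurable_fun_disk cg).
      exact: measurable_disk.
    by move=> z [].
  - by move=> z /g_V; rewrite lee_fin.
(* Dividing [main] by q'^n bounds c m by M A (q / q')^n, which tends to 0. *)
have : c * m <= 0.
  have qq'1 : `|q / q'| < 1.
    rewrite ger0_norm; first by rewrite ltr_pdivrMr// mul1r.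
    by rewrite divr_ge0// ltW.
  have lim0 : (M * A) * (q / q') ^+ n @[n --> \oo] --> (M * A) * 0.
    by apply: cvgM; [exact: cvg_cst|exact: cvg_expr].
  rewrite -[leRHS](mulr0 (M * A)); apply: (cvgr_to_ge lim0).
  apply: nearW => n; have q'n : 0 < q' ^+ n by exact: exprn_gt0.
  have qE : (q / q') ^+ n * q' ^+ n = q ^+ n by rewrite expr_div_n divfK ?gt_eqF.
  rewrite -(ler_pM2r q'n) -[leRHS]mulrA qE.
  by have := main n; lra.
by apply/negP; rewrite -ltNge mulr_gt0.
Qed.

(** The one-sided result is applied to f and to - f. *)
Lemma concentration f K z0 : cont_closed_disk f -> cont_closed_disk K ->
  closed_disk R z0 -> K z0 = 1 ->
  (forall z, closed_disk R z ->
    0 <= K z <= 1 - ((z.1 - z0.1) ^+ 2 + (z.2 - z0.2) ^+ 2) / 4) ->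
  (forall n, disk_int (fun z => K z ^+ n * f z) = 0) ->
  f z0 = 0.
Proof.
move=> cf cK Dz0 Kz0 K01 int0; apply/eqP; rewrite eq_le.
rewrite (concentration_le cf cK)//= -oppr_le0.
have := @concentration_le (fun z => - 1 * f z) K z0; rewrite mulN1r; apply=> //.
  by apply: cont_closed_diskM => //; exact: cont_closed_disk_cst.
move=> n; have cKf : cont_closed_disk (fun z => K z ^+ n * f z).
  by apply: cont_closed_diskM => //; exact: cont_closed_diskX.
rewrite -[RHS](mulr0 (- 1)) -(int0 n) -(disk_intZ _ cKf).
by apply: eq_disk_int => z _; rewrite mulrCA.
Qed.

End concentration.

(** * Fields orthogonal to all gradients: zero divergence and zero normal component *)

Section variational_lemma.
Context {R : realType}.
Local Notation mu2 := (@lebesgue_measure R \x @lebesgue_measure R)%E.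
Implicit Types (f g psi : R * R -> R) (T dT : 'I_2 -> R * R -> R) (z : R * R).

(** The exponent 1 is a convenient choice covered by the Hoelder algebra; smoothness does not refer
    to it. *)
Lemma holder_class_smooth f : (forall k, holder_class 1 k f) ->
  smooth_closed_disk f.
Proof. by move=> hf k; have [] := (Ckb_closed_diskP k 1 f).2 (hf k). Qed.

Lemma smooth_is_pderiv f i : smooth_closed_disk f ->
  is_pderiv i f (pderiv i f).
Proof. by move=> /(_ 1%N); exact: Ck_closed_disk_is_pderiv. Qed.

Lemma is_pderivX i f g n : is_pderiv i f g ->
  is_pderiv i (fun z => f z ^+ n.+1) (fun z => n.+1%:R * f z ^+ n * g z).
Proof.
apply: (is_pderiv_comp (u := fun x => x ^+ n.+1) (u' := fun x => n.+1%:R * x ^+ n)).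
  move=> x; split; first exact: exprn_derivable.
  by rewrite exp_derive /GRing.scale/= mulr1.
by move=> x; apply: cvgM; [exact: cvg_cst|exact: exprn_continuous].
Qed.

Let hM := @holder_classM R 1 ltr01 (lexx 1).
Let hX := @holder_classX R 1 ltr01 (lexx 1).

Lemma holder_class_fst k : holder_class 1 k (fun z => z.1 : R).
Proof. exact: (holder_class_coord2 ltr01 (lexx 1) k 0). Qed.

Lemma holder_class_snd k : holder_class 1 k (fun z => z.2 : R).
Proof. exact: (holder_class_coord2 ltr01 (lexx 1) k 1). Qed.

Lemma divergence_eq0 T dT : (forall i, is_pderiv i (T i) (dT i)) ->
  (forall f, smooth_closed_disk f ->
    disk_int (fun z => \sum_(i < 2) T i z * pderiv i f z) = 0) ->
  forall z, disk R z -> \sum_(i < 2) dT i z = 0.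
Proof.
move=> dTi T0 z0 Dz0.
(* The weight [w] removes the boundary term and is positive at z0, so it can be cancelled at the
   end. *)
pose w z : R := 1 - (z.1 ^+ 2 + z.2 ^+ 2).
pose K z : R := 1 - ((z.1 - z0.1) ^+ 2 + (z.2 - z0.2) ^+ 2) * 4^-1.
have hw k : holder_class 1 k w.
  apply: holder_classD; first exact: holder_class_cst.
  apply: holder_classN => //; apply: holder_classD; apply: hX.
    exact: holder_class_fst.
  exact: holder_class_snd.
have hK k : holder_class 1 k K.
  apply: holder_classD; first exact: holder_class_cst.
  apply: holder_classN => //; apply: hM; last exact: holder_class_cst.
  apply: holder_classD; apply: hX; apply: holder_classD.
  - exact: holder_class_fst.
  - exact: holder_class_cst.
  - exact: holder_class_snd.
  - exact: holder_class_cst.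
have cdT : cont_closed_disk (fun z => \sum_(i < 2) dT i z).
  by apply: cont_closed_disk_sum2 => i; have [] := dTi i.
have int0 n : disk_int (fun z => K z ^+ n * ((\sum_(i < 2) dT i z) * w z)) = 0.
  pose f z := w z * K z ^+ n.
  have sf : smooth_closed_disk f.
    by apply: holder_class_smooth => k; apply: hM => //; exact: hX.
  apply/eqP; rewrite -oppr_eq0 -[X in _ == X](T0 f sf); apply/eqP.
  rewrite (disk_int_by_parts dTi (fun i => smooth_is_pderiv i sf)); last first.
    by move=> z z1; rewrite /f /w z1 subrr mul0r.
  by congr (- _); apply: eq_disk_int => z _; rewrite /f; ring.
have w0 : w z0 != 0 by rewrite gt_eqF// subr_gt0.
apply/eqP; rewrite -(mulIr_eq0 _ (mulIf w0)); apply/eqP.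
apply: (@concentration _ (fun z => (\sum_(i < 2) dT i z) * w z) K z0) => //.
- apply: cont_closed_diskM => //; exact: holder_class_cont (hw 0%N).
- exact: holder_class_cont (hK 0%N).
- exact: disk_closed_disk.
- by rewrite /K !subrr expr0n /= addr0 mul0r subr0.
- move=> z; move/disk_closed_disk: Dz0; rewrite /closed_disk /= /K => Dz0' Dz.
  apply/andP; split => //.
  (* By the parallelogram identity |z - z0|^2 <= 2 |z|^2 + 2 |z0|^2 <= 4, hence K >= 0. *)
  have := sqr_ge0 (z.1 + z0.1); have := sqr_ge0 (z.2 + z0.2); nra.
Qed.

(** K is affine with gradient z0 / 2, so T . grad (K^(n+1)) is already a positive multiple of K^n (T
    . z0), to which concentration applies directly. *)
Lemma normal_component_eq0 T : (forall i, cont_closed_disk (T i)) ->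
  (forall f, smooth_closed_disk f ->
    disk_int (fun z => \sum_(i < 2) T i z * pderiv i f z) = 0) ->
  forall z, unit_circle R z -> normal_component T z = 0.
Proof.
move=> cT T0 z0 Cz0.
have Dz0 : closed_disk R z0 by rewrite /closed_disk /= Cz0.
pose K z : R := 2^-1 + (z.1 * (z0.1 / 2) + z.2 * (z0.2 / 2)).
have hK k : holder_class 1 k K.
  apply: holder_classD; first exact: holder_class_cst.
  apply: holder_classD; apply: hM.
  - exact: holder_class_fst.
  - exact: holder_class_cst.
  - exact: holder_class_snd.
  - exact: holder_class_cst.
have dK i : is_pderiv i K (fun=> coord2 i z0 / 2).
  have := is_pderivD (is_pderiv_cst i (2^-1 : R)) (is_pderivD
    (is_pderivM (is_pderiv_coord2 i 0) (is_pderiv_cst i (z0.1 / 2)))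
    (is_pderivM (is_pderiv_coord2 i 1) (is_pderiv_cst i (z0.2 / 2)))).
  apply: is_pderiv_ext => z _ //.
  by case: (ord2P i) => ->; rewrite /coord2 /=; ring.
(* The normal is frozen at z0; at z0 this is the normal component. *)
pose f z := \sum_(i < 2) T i z * coord2 i z0.
have cf : cont_closed_disk f.
  apply: cont_closed_disk_sum2 => i; apply: cont_closed_diskM => //.
  exact: cont_closed_disk_cst.
have cK : cont_closed_disk K by exact: holder_class_cont (hK 0%N).
have int0 n : disk_int (fun z => K z ^+ n * f z) = 0.
  have sK : smooth_closed_disk (fun z => K z ^+ n.+1).
    by apply: holder_class_smooth => k; exact: hX.
  have := T0 _ sK.
  rewrite (@eq_disk_int _ _
    (fun z => (n.+1%:R / 2) * (K z ^+ n * f z))); last first.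
    move=> z /disk_closed_disk Dz; rewrite /f !sum_ord2.
    by rewrite !(pderivE (is_pderivX n (dK _)) Dz); ring.
  rewrite disk_intZ; last first.
    by apply: cont_closed_diskM => //; exact: cont_closed_diskX.
  by move/eqP; rewrite mulf_eq0 => /orP[|/eqP//]; rewrite gt_eqF// divr_gt0.
have Cz0' : z0.1 ^+ 2 + z0.2 ^+ 2 = 1 by exact: Cz0.
apply: (@concentration _ f K z0) => //.
- by rewrite /K; lra.
(* As |z0| = 1, 1 - K = |z - z0|^2 / 4 + (1 - |z|^2) / 4. Nonnegativity of K follows from |z + z0|^2
   >= 0. *)
- move=> z; rewrite /closed_disk /= /K => Dz.
  have := sqr_ge0 (z.1 + z0.1); have := sqr_ge0 (z.2 + z0.2) => ? ?.
  by apply/andP; split; nra.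
Qed.

(** 1 - s^(n+1) is (1 - s) times 1 + s + ... + s^n, a sum of n + 1 terms each at least s^n. *)
Lemma ler_natX_sub (s : R) n : 0 <= s -> s <= 1 ->
  n.+1%:R * s ^+ n * (1 - s) <= 1.
Proof.
move=> s0 s1; have sn m : s ^+ m <= 1 by exact: exprn_ile1.
apply: (@le_trans _ _ (1 - s ^+ n.+1)); last by rewrite gerBl exprn_ge0.
elim: n => [|n IH]; first by rewrite expr0 expr1; lra.
have E1 : s ^+ n.+1 = s * s ^+ n by rewrite exprS.
have E2 : s ^+ n.+2 = s * (s * s ^+ n) by rewrite !exprS.
have := sn n.+1; have := exprn_ge0 n.+1 s0; move: IH.
rewrite -[n.+2%:R]natr1 E1 E2; move: (s ^+ n) (n.+1%:R : R) => x N IH _ sx1.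
(* The gap between the two sides at n + 1 is the sum of this product, s times the gap at n, and the
   next one. *)
have : 0 <= s * (1 - s * x - N * x * (1 - s)) by rewrite mulr_ge0// subr_ge0.
have : 0 <= (1 - s) * (1 - s * x) by rewrite mulr_ge0// subr_ge0.
by lra.
Qed.

Lemma cvg_natX (s : R) : 0 <= s -> s < 1 ->
  (fun n => n.+1%:R * s ^+ n) @ \oo --> (0 : R).
Proof.
move=> s0 s1; pose t := Num.sqrt s.
have t0 : 0 <= t by exact: sqrtr_ge0.
(* n s^(n-1) = n t^(n-1) * t^(n-1) with t = sqrt s, and n t^(n-1) <= 1 / (1 - t). *)
have st : s = t ^+ 2 by rewrite sqr_sqrtr.
have t1 : t < 1 by rewrite -(expr_lt1 (n := 2))// -st.
have t1' : 0 < 1 - t by rewrite subr_gt0.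
apply: (@squeeze_cvgr _ _ _ _ (fun=> 0) (fun n => (1 - t)^-1 * t ^+ n)).
- apply: nearW => n; rewrite mulr_ge0 ?exprn_ge0//=.
  rewrite st -exprM mulnC muln2 -addnn exprD mulrA ler_wpM2r ?exprn_ge0//.
  by rewrite -(ler_pM2r t1') mulVf ?gt_eqF// ler_natX_sub// ltW.
- exact: cvg_cst.
- rewrite -[X in _ --> X](mulr0 (1 - t)^-1).
  by apply: cvgM; [exact: cvg_cst|apply: cvg_expr; rewrite ger0_norm].
Qed.

(** A Lipschitz function vanishing on the circle is bounded by a multiple of 1 - |z| <= 1 - |z|^2.
    The centre has no radial projection, and [h 0 = 0] settles it. *)
Lemma vanishing_bound h (dh : 'I_2 -> R * R -> R) :
  (forall i, is_pderiv i h (dh i)) ->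
  (forall z, unit_circle R z -> h z = 0) -> h 0 = 0 ->
  exists2 C, 0 <= C & forall z, closed_disk R z ->
    `|h z| <= C * (1 - (z.1 ^+ 2 + z.2 ^+ 2)).
Proof.
move=> dhi hC h0; have [C C0 hL] := is_pderiv_lipschitz dhi.
exists C => // z Dz; pose s : R := z.1 ^+ 2 + z.2 ^+ 2; rewrite -/s.
have s1 : s <= 1 by exact: Dz.
have [z0|z0] := eqVneq z 0.
  by rewrite z0 h0 normr0 mulr_ge0// subr_ge0.
have s0 : 0 < s.
  rewrite lt_neqAle addr_ge0 ?sqr_ge0// andbT eq_sym paddr_eq0 ?sqr_ge0//.
  rewrite !sqrf_eq0; apply: contra z0 => /andP[/eqP a0 /eqP b0].
  by rewrite [z]surjective_pairing a0 b0.
(* Compare z with its radial projection to the circle. *)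
pose r := Num.sqrt s.
have r0 : 0 < r by rewrite sqrtr_gt0.
have r2 : r ^+ 2 = s by rewrite sqr_sqrtr// ltW.
have r1 : r <= 1 by rewrite -(expr_le1 (n := 2) _ (ltW r0))// r2.
have Cz : unit_circle R (r^-1 *: z).
  suff : (r^-1 * z.1) ^+ 2 + (r^-1 * z.2) ^+ 2 = 1 by [].
  rewrite !exprMn -mulrDr -/s -r2 exprVn mulVf//.
  by rewrite expf_neq0// gt_eqF.
have Dz' : closed_disk R (r^-1 *: z) by rewrite /closed_disk /= Cz.
have := hL z _ Dz Dz'; rewrite (hC _ Cz) subr0 => hz.
apply: le_trans hz _; apply: ler_wpM2l => //.
have z_le : `|z| <= r.
  have sqr_le (a : R) : a ^+ 2 <= s -> `|a| <= r.
    by rewrite -r2 -(real_normK (num_real a)) ler_sqr ?nnegrE// ltW.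
  by rewrite prod_normE ge_max !sqr_le// /s ?lerDl ?lerDr sqr_ge0.
rewrite -[X in X - _]scale1r -scalerBl prod_norm_scale.
rewrite ler0_norm; last by rewrite subr_le0 invf_ge1.
apply: (@le_trans _ _ ((r^-1 - 1) * r)).
  by rewrite opprB ler_wpM2l// subr_ge0 invf_ge1.
by rewrite mulrBl mulVf ?gt_eqF// mul1r -r2; nra.
Qed.

Lemma disk_int_tangential T (dT : 'I_2 -> 'I_2 -> R * R -> R) psi
    (dpsi : 'I_2 -> R * R -> R) :
  (forall i j, is_pderiv i (T j) (dT i j)) ->
  (forall z, disk R z -> \sum_(i < 2) dT i i z = 0) ->
  (forall z, unit_circle R z -> normal_component T z = 0) ->
  (forall i, is_pderiv i psi (dpsi i)) ->
  disk_int (fun z => \sum_(i < 2) T i z * dpsi i z) = 0.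
Proof.
move=> dTi div0 normal0 dpsii.
pose s z : R := z.1 ^+ 2 + z.2 ^+ 2.
have ds i : is_pderiv i s (fun z => 2 * coord2 i z).
  have := is_pderivD (is_pderivX 1 (is_pderiv_coord2 i 0))
    (is_pderivX 1 (is_pderiv_coord2 i 1)).
  apply: is_pderiv_ext => z _ //.
  by case: (ord2P i) => -> /=; rewrite !expr1 /coord2 /=; ring.
pose g z := \sum_(i < 2) T i z * dpsi i z.
pose h := normal_component T.
(* This is T . grad (psi (1 - s^(n+1))) expanded, with grad s = 2 z and h = T . z. *)
pose F n z := g z * (1 - s z ^+ n.+1) - 2 * psi z * h z * (n.+1%:R * s z ^+ n).
have cT i : cont_closed_disk (T i) by have [] := dTi 0 i.
have cdpsi i : cont_closed_disk (dpsi i) by have [] := dpsii i.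
have cpsi : cont_closed_disk psi by have [] := dpsii 0.
have cs : cont_closed_disk s by have [] := ds 0.
have cg : cont_closed_disk g.
  by apply: cont_closed_disk_sum2 => i; exact: cont_closed_diskM.
have dh i : is_pderiv i h (fun z => \sum_(j < 2)
    (dT i j z * coord2 j z + T j z * (i == j)%:R)).
  apply: is_pderiv_sum => j; exact: is_pderivM (dTi i j) (is_pderiv_coord2 i j).
have ch : cont_closed_disk h by have [] := dh 0.
have cF n : cont_closed_disk (F n).
  apply: cont_closed_diskD.
    apply: cont_closed_diskM => //; apply: cont_closed_diskD.
      exact: cont_closed_disk_cst.
    under eq_fun do rewrite -mulN1r; apply: cont_closed_diskM.
      exact: cont_closed_disk_cst.
    exact: cont_closed_diskX.
  under eq_fun do rewrite -mulN1r; apply: cont_closed_diskM.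
    exact: cont_closed_disk_cst.
  apply: cont_closed_diskM; apply: cont_closed_diskM => //.
  - by apply: cont_closed_diskM => //; exact: cont_closed_disk_cst.
  - exact: cont_closed_disk_cst.
  - exact: cont_closed_diskX.
have F0 n : disk_int (F n) = 0.
  have dchi i : is_pderiv i (fun z => psi z * (1 + - 1 * s z ^+ n.+1)) _ :=
    is_pderivM (dpsii i) (is_pderivD (is_pderiv_cst i 1)
      (is_pderivM (is_pderiv_cst i (- 1)) (is_pderivX n (ds i)))).
  have := disk_int_by_parts (fun i => dTi i i) dchi.
  rewrite [X in _ -> _ = - X](_ : _ = 0) => [H|]; last first.
    rewrite -[RHS](mul0r (disk_int (fun=> 0 : R))) -disk_intZ; last first.
      exact: cont_closed_disk_cst.
    by apply: eq_disk_int => z Dz; rewrite div0// !mul0r.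
  rewrite oppr0 in H; rewrite -[RHS]H => [|z z1]; last first.
    by rewrite /s z1 expr1n mulN1r subrr mulr0.
  apply: eq_disk_int => z _; rewrite /F /g /h /normal_component !sum_ord2; ring.
have [M M0 gM] := cont_closed_disk_bounded cg.
have [M' M'0 psiM] := cont_closed_disk_bounded cpsi.
have [C C0 hC] : exists2 C, 0 <= C & forall z, closed_disk R z ->
    `|h z| <= C * (1 - (z.1 ^+ 2 + z.2 ^+ 2)).
  apply: vanishing_bound dh normal0 _.
  by rewrite /h /normal_component sum_ord2 /coord2 /= !mulr0 addr0.
have s01 z : closed_disk R z -> 0 <= s z <= 1.
  by move=> Dz; rewrite addr_ge0 ?sqr_ge0.
(* Uniformity in n: the factor 1 - s in the bound on [h] absorbs (n+1) s^n. *)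
have F_le n z : disk R z -> `|F n z| <= M + 2 * M' * C.
  move=> /disk_closed_disk Dz; have /andP[s0 s1] := s01 z Dz.
  apply: le_trans (ler_normB _ _) _; apply: lerD.
    rewrite normrM -[leRHS]mulr1 ler_pM ?gM//.
    by rewrite ger0_norm ?subr_ge0 ?exprn_ile1// gerBl exprn_ge0.
  rewrite !normrM (ger0_norm (ler0n _ 2)) -!mulrA ler_wpM2l// ler_pM ?psiM//.
  rewrite -normrM [`|_ * s z ^+ n|]ger0_norm ?mulr_ge0 ?exprn_ge0//.
  apply: le_trans (ler_wpM2r _ (hC z Dz)) _; first by rewrite mulr_ge0 ?exprn_ge0.
  rewrite -mulrA -[leRHS]mulr1 ler_wpM2l// mulrC.
  exact: ler_natX_sub.
(* On the open disk s < 1, so s^(n+1) and (n+1) s^n both tend to 0. *)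
have F_cvg z : disk R z -> F n z @[n --> \oo] --> g z.
  move=> Dz; have /andP[s0 _] := s01 z (disk_closed_disk Dz).
  have s1 : s z < 1 by exact: Dz.
  have cX : s z ^+ n.+1 @[n --> \oo] --> (0 : R).
    have := @cvg_expr R (s z); rewrite ger0_norm// => /(_ s1).
    by rewrite -(cvg_shiftn 1); under eq_fun do rewrite addn1.
  rewrite -[X in _ --> X](_ : g z * (1 - 0) - 2 * psi z * h z * 0 = _); last first.
    by rewrite subr0 mulr1 mulr0 subr0.
  apply: cvgB; apply: cvgM; [exact: cvg_cst| |exact: cvg_cst|exact: cvg_natX].
  by apply: cvgB => //; exact: cvg_cst.
have [] := @dominated_convergence _ _ _ mu2 (disk R) measurable_disk
  (fun n z => (F n z)%:E) (EFin \o g) (fun=> (M + 2 * M' * C)%:E).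
- by move=> n; apply/measurable_EFinP; exact: measurable_fun_disk.
- by apply/measurable_EFinP; exact: measurable_fun_disk.
- by apply: aeW => z Dz; apply: cvg_EFin; [exact: nearW|exact: F_cvg].
- exact: integrable_disk (@cont_closed_disk_cst R (M + 2 * M' * C)).
- by apply: aeW => z n Dz; rewrite lee_fin; exact: F_le.
move=> _ _ lim_int; rewrite /disk_int /Rintegral.
suff -> : (\int[mu2]_(z in disk R) (g z)%:E = 0)%E by [].
apply/esym; apply: cvg_unique lim_int; first exact: ereal_hausdorff.
rewrite (_ : (fun n => _) = cst 0%E); first exact: cvg_cst.
apply/funext => n /=; rewrite -[RHS]/(0%:E) -(F0 n) /disk_int /Rintegral fineK//.
by apply: integrable_fin_num; [exact: measurable_disk|exact: integrable_disk].
Qed.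

End variational_lemma.

(** * First variation of the total torsion *)

Section coulomb_frames.
Context {R : realType}.
Implicit Types (N : 'I_2 -> R * R -> 'rV[R]_4) (phi psi : R * R -> R) (z : R * R).

Lemma holder_class_is_pderiv (V : normedModType R) beta k (f : R * R -> V) i :
  holder_class beta k.+1 f -> is_pderiv i f (pderiv i f).
Proof. by move=> /Ckb_closed_diskP[/Ck_closed_disk_is_pderiv]. Qed.

Lemma holder_class_pderiv (V : normedModType R) beta k (f : R * R -> V) i :
  holder_class beta k.+1 f -> holder_class beta k (pderiv i f).
Proof.
move=> fd; have [g fg] := fd i; apply: holder_class_ext => z Dz.
by rewrite (pderivE fg).
Qed.

Lemma holder_class_dotv beta k n (f g : R * R -> 'rV[R]_n) :
  0 < beta -> beta <= 1 -> holder_class beta k f -> holder_class beta k g ->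
  holder_class beta k (fun z => dotv (f z) (g z)).
Proof.
move=> b0 b1 /holder_class_rV hf /holder_class_rV hg.
by apply: holder_class_sum => j; exact: holder_classM.
Qed.

Lemma holder_class_torsion beta k N sigma i theta : 0 < beta -> beta <= 1 ->
  (forall rho, holder_class beta k.+1 (N rho)) ->
  holder_class beta k (torsion N sigma i theta).
Proof.
move=> b0 b1 hN; apply: holder_class_dotv => //.
  exact: holder_class_pderiv.
apply/holder_class_rV => j; apply: (holder_class_le b0 b1).
by move: j; exact/holder_class_rV.
Qed.

Lemma torsion_ext N N' sigma i theta z : C1_frame N ->
  (forall rho w, closed_disk R w -> N rho w = N' rho w) -> closed_disk R z ->
  torsion N sigma i theta z = torsion N' sigma i theta z.
Proof.
move=> dN NN' Dz.
have dN' : is_pderiv i (N' sigma) (pderiv i (N sigma)).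
  by apply: is_pderiv_ext (dN sigma i) => // w Dw; exact: NN'.
by rewrite /torsion (pderivE dN' Dz) -(NN' theta z Dz).
Qed.

Lemma derive_disk_ext i (f f' : R * R -> R) z :
  (forall w, disk R w -> f w = f' w) -> disk R z ->
  'D_(basis_vec R i) f z = 'D_(basis_vec R i) f' z.
Proof.
move=> ff' Dz; apply: near_eq_derive; have := near_disk Dz.
by apply: filterS => w; exact: ff'.
Qed.

Lemma is_pderiv_derive i (f g : R * R -> R) z : is_pderiv i f g -> disk R z ->
  'D_(basis_vec R i) f z = g z.
Proof. by move=> [_ _ fg] /fg []. Qed.

(** Expand the square of T + eps grad psi and integrate; the total torsion contributes an overall
    factor 2. *)
Lemma total_torsion_rotate_frame N psi (eps : R) :
  orthonormal_frame N -> C1_frame N ->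
  (forall i, cont_closed_disk (torsion N 0 i 1)) ->
  (forall i, is_pderiv i psi (pderiv i psi)) ->
  total_torsion (rotate_frame (fun z => eps * psi z) N) =
  total_torsion N +
  (4 * disk_int (fun z => \sum_(i < 2) torsion N 0 i 1 z * pderiv i psi z)) * eps +
  (2 * disk_int (fun z => \sum_(i < 2) pderiv i psi z ^+ 2)) * eps ^+ 2.
Proof.
move=> oN dN cT dpsi.
have deps i : is_pderiv i (fun z => eps * psi z) (fun z => eps * pderiv i psi z).
  apply: is_pderiv_ext (is_pderivM (is_pderiv_cst i eps) (dpsi i)) => // z _.
  by rewrite mul0r add0r.
have cpsi i : cont_closed_disk (pderiv i psi) by have [] := dpsi i.
pose A z := torsion N 0 0 1 z ^+ 2 + torsion N 0 1 1 z ^+ 2.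
pose B z := \sum_(i < 2) torsion N 0 i 1 z * pderiv i psi z.
pose C z := \sum_(i < 2) pderiv i psi z ^+ 2.
have cA : cont_closed_disk A by apply: cont_closed_diskD; exact: cont_closed_diskX.
have cB : cont_closed_disk B.
  by apply: cont_closed_disk_sum2 => i; exact: cont_closed_diskM.
have cC : cont_closed_disk C.
  by apply: cont_closed_disk_sum2 => i; exact: cont_closed_diskX.
have cZ (c : R) f : cont_closed_disk f -> cont_closed_disk (fun z => c * f z).
  by move=> cf; apply: cont_closed_diskM => //; exact: cont_closed_disk_cst.
rewrite /total_torsion -!/(disk_int _).
rewrite (@eq_disk_int _ _ (fun z => A z + ((2 * eps) * B z + eps ^+ 2 * C z))).
  have cZB := cZ (2 * eps) _ cB; have cZC := cZ (eps ^+ 2) _ cC.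
  rewrite (disk_intD cA (cont_closed_diskD cZB cZC)) (disk_intD cZB cZC).
  rewrite (disk_intZ _ cB) (disk_intZ _ cC); ring.
move=> z /disk_closed_disk Dz.
have tr i := torsion_rotate_frame oN dN (deps i) Dz.
transitivity ((torsion N 0 0 1 z + eps * pderiv 0 psi z) ^+ 2 +
    (torsion N 0 1 1 z + eps * pderiv 1 psi z) ^+ 2).
  by congr (_ ^+ 2 + _ ^+ 2); [exact: (tr 0)|exact: (tr 1)].
have square_sum (a b c d : R) : (a + eps * c) ^+ 2 + (b + eps * d) ^+ 2 =
    a ^+ 2 + b ^+ 2 + ((2 * eps) * (a * c + b * d) + eps ^+ 2 * (c ^+ 2 + d ^+ 2)).
  by ring.
by rewrite square_sum /A /B /C !sum_ord2.
Qed.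

(** The derivative at 0 is the linear coefficient, and derivatives are unique. *)
Lemma is_derive_quadratic (a b c d : R) :
  is_derive (0 : R) 1 (fun x => a + b * x + c * x ^+ 2) d <-> b = d.
Proof.
have dq : is_derive (0 : R) 1 (fun x => a + b * x + c * x ^+ 2) b.
  have dX : is_derive (0 : R) 1 (fun x : R => x ^+ 2) 0.
    split; first exact: exprn_derivable.
    by rewrite exp_derive expr1 scaler0 scale0r.
  have d1 := is_deriveD (is_derive_cst a (0 : R) 1)
    (is_deriveZ b (is_derive_id (0 : R) 1)).
  have := is_deriveD d1 (is_deriveZ c dX).
  by rewrite scaler0 addr0 add0r [b *: 1]mulr1.
by split=> [[_ <-]|<-//]; have [_ ->] := dq.
Qed.

(** The weak Euler-Lagrange equation: T is orthogonal in L^2 to the gradients of all smooth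
    functions. *)
Lemma coulomb_frameP k beta X N :
  normal_frame k beta X N -> C1_frame N ->
  (forall i, cont_closed_disk (torsion N 0 i 1)) ->
  coulomb_frame k beta X N <->
  forall psi, smooth_closed_disk psi ->
    disk_int (fun z => \sum_(i < 2) torsion N 0 i 1 z * pderiv i psi z) = 0.
Proof.
move=> frN dN cT; have [_ frN2] := frN.
have oN : orthonormal_frame N by move=> z Dz; have [] := frN2 z Dz.
have critical psi : smooth_closed_disk psi ->
    is_derive (0 : R) 1
      (fun eps : R => total_torsion (rotate_frame (fun z => eps * psi z) N)) 0
    <-> disk_int (fun z => \sum_(i < 2) torsion N 0 i 1 z * pderiv i psi z) = 0.
  move=> spsi; under eq_fun do rewrite (total_torsion_rotate_frame _ oN dN cT
    (fun i => smooth_is_pderiv i spsi)).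
  rewrite is_derive_quadratic; split=> [/eqP|->]; last by rewrite mulr0.
  by rewrite mulf_eq0 pnatr_eq0 => /eqP.
split=> [[_ crit] psi spsi|int0]; first by apply/critical => //; exact: crit.
by split=> // psi spsi; apply/critical => //; exact: int0.
Qed.

End coulomb_frames.

(** * The Neumann problem for the rotation angle *)

Theorem proposition20 (R : realType) (k : nat) (beta : R)
    (X : R * R -> 'rV[R]_4) (Nt N : 'I_2 -> R * R -> 'rV[R]_4)
    (phi : R * R -> R)
    (hk : (3 <= k)%N) (hbeta0 : 0 < beta) (hbeta1 : beta < 1)
    (hX : immersion k beta X) (hconf : conformal X)
    (hNt : normal_frame k beta X Nt)
    (hphi : Ckb_closed_disk k.-1 beta phi)
    (hN : forall sigma z, closed_disk R z -> Nt sigma z = rotate_frame phi N sigma z) :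
  coulomb_frame k beta X N <->
  ((forall z, disk R z ->
      laplacian phi z = divergence (fun i => torsion Nt 0 i 1) z) /\
   (forall z, unit_circle R z ->
      normal_derivative phi z = normal_component (fun i => torsion Nt 0 i 1) z)).
Proof.
have b1 := ltW hbeta1.
have frN : normal_frame k beta X N.
  (* N is the rotation of [Nt] by - phi on the closed disk, hence inherits regularity, normality and
     orientation. *)
  apply: (normal_frame_ext (N := rotate_frame (fun z => - phi z) Nt)).
    move=> sigma z Dz; rewrite -(rotate_frameK N phi sigma z) /rotate_frame.
    by rewrite !hN.
  apply: normal_frame_rotate_frame => //; apply/Ckb_closed_diskP.
  by apply: holder_classN => //; apply/Ckb_closed_diskP.
(* With k >= 3 the frames and phi are at least C^2, so the torsion coefficients are at least C^1. *)
move: k hk hX hNt hphi frN => [//|[//|[//|k]]] _ _ hNt hphi frN.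
have hphi' : holder_class beta k.+2 phi by apply/Ckb_closed_diskP.
have [hN' frN2] := frN.
have hNr rho : holder_class beta k.+2 (N rho) by apply/Ckb_closed_diskP; exact: hN'.
have dN : C1_frame N by move=> rho i; exact: holder_class_is_pderiv (hNr rho).
have oN : orthonormal_frame N by move=> z Dz; have [] := frN2 z Dz.
have dNt : C1_frame Nt.
  move=> rho i; have [/(_ rho)/Ckb_closed_diskP hNtr _] := hNt.
  exact: holder_class_is_pderiv hNtr.
pose T i := torsion N 0 i 1.
have hT i : holder_class beta k.+1 (T i) by exact: holder_class_torsion.
have dT i j : is_pderiv i (T j) (pderiv i (T j)).
  exact: holder_class_is_pderiv (hT j).
have cT i : cont_closed_disk (T i) by have [] := dT 0 i.
have dphi i : is_pderiv i phi (pderiv i phi).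
  exact: holder_class_is_pderiv hphi'.
have ddphi i j : is_pderiv i (pderiv j phi) (pderiv i (pderiv j phi)).
  exact: holder_class_is_pderiv (holder_class_pderiv j hphi').
have TtE i z : closed_disk R z -> torsion Nt 0 i 1 z = T i z + pderiv i phi z.
  move=> Dz; rewrite -(torsion_rotate_frame oN dN (dphi i) Dz).
  exact: torsion_ext.
have divE z : disk R z ->
    laplacian phi z = divergence (fun i => torsion Nt 0 i 1) z <->
    \sum_(i < 2) pderiv i (T i) z = 0.
  move=> Dz.
  (* [laplacian] and [divergence] use pointwise derivatives, which agree with [pderiv] on the open
     disk. *)
  have D2 i : 'D_(basis_vec R i) (fun w => 'D_(basis_vec R i) phi w) z =
      pderiv i (pderiv i phi) z.
    rewrite -(is_pderiv_derive (ddphi i i) Dz); apply: derive_disk_ext => // w Dw.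
    by rewrite (is_pderiv_derive (dphi i) Dw).
  have DT i : 'D_(basis_vec R i) (torsion Nt 0 i 1) z =
      pderiv i (T i) z + pderiv i (pderiv i phi) z.
    rewrite -(is_pderiv_derive (is_pderivD (dT i i) (ddphi i i)) Dz).
    by apply: derive_disk_ext => // w /disk_closed_disk; exact: TtE.
  have cancel (a b c d : R) : a + b = (c + a) + (d + b) <-> c + d = 0.
    by split; lra.
  have lapE : laplacian phi z =
      pderiv 0 (pderiv 0 phi) z + pderiv 1 (pderiv 1 phi) z.
    rewrite /laplacian /divergence sum_ord2; exact: (congr2 +%R (D2 0) (D2 1)).
  have divTE : divergence (fun i => torsion Nt 0 i 1) z =
      (pderiv 0 (T 0) z + pderiv 0 (pderiv 0 phi) z) +
      (pderiv 1 (T 1) z + pderiv 1 (pderiv 1 phi) z).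
    rewrite /divergence sum_ord2; exact: (congr2 +%R (DT 0) (DT 1)).
  rewrite lapE divTE sum_ord2; exact: cancel.
have normE z : unit_circle R z ->
    normal_derivative phi z = normal_component (fun i => torsion Nt 0 i 1) z <->
    normal_component T z = 0.
  move=> z1; have Dz : closed_disk R z by rewrite /closed_disk /= z1.
  rewrite /normal_derivative /normal_component !sum_ord2 (TtE 0) // (TtE 1)//.
  have cancel (a b p q x y : R) :
    p * x + q * y = (a + p) * x + (b + q) * y <-> a * x + b * y = 0.
    by split; lra.
  exact: cancel.
(* By [divE] and [normE] the two equations concern T alone, and are compared with its weak
   equation. *)
rewrite coulomb_frameP//; split=> [int0|[lap norm] psi spsi].
  split=> z Dz.
    by apply/divE => //; exact: (divergence_eq0 (fun i => dT i i) int0).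
  by apply/normE => //; exact: (normal_component_eq0 cT int0).
exact: (disk_int_tangential dT (fun z Dz => (divE z Dz).1 (lap z Dz))
  (fun z z1 => (normE z z1).1 (norm z z1)) (fun i => smooth_is_pderiv i spsi)).
Qed.
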